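(* Let $d\ge1$. Let $V\in L^\infty_{\mathrm{loc}}(\mathbb{R}^d;\mathbb{R})$ satisfy $V\ge0$ and $V(x)\to+\infty$ as $x\to\infty$, and let $b\in L^\infty(\mathbb{R}^d)$ be non-negative. If the damped wave equation $$\partial_t^2u+Pu+b(x)\partial_tu=0,\qquad P=V(x)-\tfrac12\Delta,$$ is uniformly stable, then there exist $T>0$ and $c>0$ such that for all $(x_0,\nu_0)\in\mathbb{R}^d\times S^{d-1}$ and all $r>0$, $$\frac{1}{2T}\int_{-T}^T (b*\kappa_r)(x_0+t\nu_0)\,dt\ \ge\ c.$$
   Context: $B_r(x)$ is the open Euclidean ball of radius $r$ centred at $x$, $|A|$ is the $d$-dimensional Lebesgue measure of $A$, $\kappa:=\frac{1}{|B_1(0)|}\mathbf{1}_{B_1(0)}$ and $\kappa_r(x):=r^{-d}\kappa(x/r)$ for $r>0$. Operator and equation: $P=V-\frac12\Delta$ with domain $\mathrm{dom}\,P=\{u\in L^2(\mathbb{R}^d): (V-\frac12\Delta)u\in L^2(\mathbb{R}^d)\}$ is self-adjoint and positive definite. Let $\mathfrak{H}=\mathrm{dom}\,P^{1/2}\oplus L^2(\mathbb{R}^d)$ be the Hilbert space with inner product $((u_1,v_1),(u_2,v_2))_{\mathfrak H}=(P^{1/2}u_1,P^{1/2}u_2)_{L^2}+(v_1,v_2)_{L^2}$. The damped wave operator is $$\mathscr{A}_b=\begin{pmatrix}0&1\\-P&-b\end{pmatrix},\qquad \mathrm{dom}\,\mathscr{A}_b=\mathrm{dom}\,P\oplus\mathrm{dom}\,P^{1/2},$$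 acting on $\mathfrak{H}$; it generates a strongly continuous semigroup $(e^{t\mathscr{A}_b})_{t\ge0}$ on $\mathfrak H$, which solves the damped wave equation $\partial_t^2u+Pu+b\,\partial_tu=0$ with $U=(u,\partial_tu)$. Uniform stability: the damped wave equation is uniformly stable if there exist $C>0$, $\tau>0$ such that $\|e^{t\mathscr{A}_b}\|_{\mathcal{B}(\mathfrak{H})}\le Ce^{-t/\tau}$ for all $t\ge0$. *)

(* Defs.v *)
From HB Require Import structures.
From mathcomp Require Import all_boot all_order all_algebra.
From mathcomp Require Import all_classical all_reals all_analysis.
From mathcomp Require Import complex.

Set Implicit Arguments.
Unset Strict Implicit.
Unset Printing Implicit Defensive.
Import Order.TTheory GRing.Theory Num.Theory.
Import numFieldNormedType.Exports.

Local Open Scope classical_set_scope.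
Local Open Scope complex_scope.
Local Open Scope ring_scope.

(** The library has no product of finitely many copies of a measure.  Row
    vectors get the product sigma-algebra, and the [d]-dimensional Lebesgue
    measure is built by splitting off the first coordinate. *)

Fact rV_display : measure_display. Proof. exact: default_measure_display. Qed.

Section rV_measurable.
Variables (R : realType) (n : nat).

Definition rV_coord (i : 'I_n) (x : 'rV[R]_n) : measurableTypeR R := x ord0 i.

Let rV_set0 : g_sigma_preimage rV_coord set0.
Proof. exact: sigma_algebra0. Qed.

Let rV_setC A : g_sigma_preimage rV_coord A -> g_sigma_preimage rV_coord (~` A).
Proof. exact: sigma_algebraC. Qed.

Let rV_bigcup (F : (set 'rV[R]_n)^nat) :
  (forall i, g_sigma_preimage rV_coord (F i)) ->
  g_sigma_preimage rV_coord (\bigcup_i (F i)).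
Proof. exact: sigma_algebra_bigcup. Qed.

HB.instance Definition _ := @isMeasurable.Build rV_display
  'rV[R]_n (g_sigma_preimage rV_coord) rV_set0 rV_setC rV_bigcup.

Lemma measurable_rV_coord (i : 'I_n) : measurable_fun [set: 'rV[R]_n] (rV_coord i).
Proof.
move=> _ Y mY; rewrite setTI; apply: sub_sigma_algebra => /=.
rewrite -bigcup_seq/=; exists i => /=; first by rewrite mem_index_enum.
by exists Y => //; rewrite setTI.
Qed.

Lemma measurable_fun_rV d (T : measurableType d) (f : T -> 'rV[R]_n) :
  (forall i, measurable_fun [set: T] (rV_coord i \o f)) ->
  measurable_fun [set: T] f.
Proof.
move=> mf.
suff H : g_sigma_preimage rV_coord `<=`
    [set A | d.-measurable ([set: T] `&` f @^-1` A)].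
  by move=> _ A mA; exact: H.
apply: smallest_sub.
  split; rewrite /=.
  - by rewrite preimage_set0 setI0.
  - move=> A; rewrite /= !setTI setTD preimage_setC => mA.
    exact: measurableC.
  - move=> F mF; rewrite /= setTI preimage_bigcup.
    by apply: bigcup_measurable => k _; have := mF k; rewrite /= setTI.
rewrite -bigcup_seq => A [i /= _ [B mB <-]] /=.
have := mf i measurableT B mB.
by rewrite !setTI.
Qed.

End rV_measurable.

Section lebesgue_measure_rV.
Variable R : realType.

Definition rV_cons n (p : measurableTypeR R * 'rV[R]_n) : 'rV[R]_n.+1 :=
  row_mx (p.1)%:M p.2 : 'rV[R]_(1 + n).

Lemma measurable_rV_cons n : measurable_fun [set: _] (@rV_cons n).
Proof.
apply: measurable_fun_rV => i.
case: (unliftP ord0 i) => [j ->|->].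
  have -> : rV_coord (lift ord0 j) \o @rV_cons n = rV_coord j \o snd.
    apply/funext => p /=; rewrite /rV_coord /rV_cons.
    rewrite (_ : lift ord0 j = rshift 1 j); last exact/val_inj.
    by rewrite (@row_mxEr _ 1 1 n).
  apply: measurableT_comp; first exact: measurable_rV_coord.
  exact: measurable_snd.
have -> : rV_coord ord0 \o @rV_cons n = fst.
  apply/funext => p /=; rewrite /rV_coord /rV_cons.
  rewrite (_ : ord0 = lshift n (ord0 : 'I_1)); last exact/val_inj.
  by rewrite (@row_mxEl _ 1 1 n) mxE eqxx mulr1n.
exact: measurable_fst.
Qed.

Definition rV_uncons n (x : 'rV[R]_n.+1) : measurableTypeR R * 'rV[R]_n :=
  (x ord0 ord0, \row_j x ord0 (lift ord0 j)).

Lemma measurable_rV_uncons n : measurable_fun [set: _] (@rV_uncons n).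
Proof.
apply: measurable_fun_pair; first exact: (measurable_rV_coord ord0).
apply: measurable_fun_rV => i.
have -> : rV_coord i \o (fun x : 'rV[R]_n.+1 => \row_j x ord0 (lift ord0 j)) =
    rV_coord (lift ord0 i).
  by apply/funext => x /=; rewrite /rV_coord mxE.
exact: measurable_rV_coord.
Qed.

Lemma rV_consK n : cancel (@rV_cons n) (@rV_uncons n).
Proof.
case=> a v; rewrite /rV_uncons /rV_cons; congr pair.
  rewrite (_ : ord0 = lshift n (ord0 : 'I_1)); last exact/val_inj.
  by rewrite (@row_mxEl _ 1 1 n) mxE eqxx mulr1n.
apply/rowP => j; rewrite mxE.
rewrite (_ : lift ord0 j = rshift 1 j); last exact/val_inj.
by rewrite (@row_mxEr _ 1 1 n).
Qed.

Section step.
Variables (n : nat) (mu : {sigma_finite_measure set 'rV[R]_n -> \bar R}).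

Definition lebesgue_rV_step : set 'rV[R]_n.+1 -> \bar R :=
  pushforward (lebesgue_measure \x mu)%E (@rV_cons n).

Let step0 : lebesgue_rV_step set0 = 0%E.
Proof. by rewrite /lebesgue_rV_step /pushforward preimage_set0 measure0. Qed.

Let step_ge0 A : (0 <= lebesgue_rV_step A)%E.
Proof. by rewrite /lebesgue_rV_step /pushforward measure_ge0. Qed.

Let step_additive : semi_sigma_additive lebesgue_rV_step.
Proof.
move=> F mF tF mUF; rewrite /lebesgue_rV_step /pushforward preimage_bigcup.
have m A : measurable A -> measurable (@rV_cons n @^-1` A).
  by move=> mA; rewrite -[X in measurable X]setTI; exact: measurable_rV_cons.
apply: measure_semi_sigma_additive.
- by move=> k; exact: m.
- apply/trivIsetP => /= i j _ _ ij; rewrite -preimage_setI.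
  by move/trivIsetP : tF => /(_ _ _ _ _ ij) ->//; rewrite preimage_set0.
- by rewrite -preimage_bigcup; exact: m.
Qed.

HB.instance Definition _ := isMeasure.Build _ _ _
  lebesgue_rV_step step0 step_ge0 step_additive.

Let step_sigma_finite : sigma_finite setT lebesgue_rV_step.
Proof.
have /sigma_finiteP[F [TF ndF Foo]] :=
  sigma_finiteT (@lebesgue_measure R : {sigma_finite_measure set _ -> \bar R}).
have /sigma_finiteP[G [TG ndG Goo]] := sigma_finiteT mu.
exists (fun k => @rV_uncons n @^-1` (F k `*` G k)).
  rewrite -preimage_bigcup [X in _ @^-1` X](_ : _ = setT) ?preimage_setT//.
  rewrite -subTset => -[x y] _.
  have [i _ Fx] : (\bigcup_i F i) x by rewrite -TF.
  have [j _ Gy] : (\bigcup_i G i) y by rewrite -TG.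
  exists (maxn i j) => //; split => /=.
    by move: x Fx; exact/subsetPset/ndF/leq_maxl.
  by move: y Gy; exact/subsetPset/ndG/leq_maxr.
move=> k; have [mF Fk] := Foo k; have [mG Gk] := Goo k; split.
  rewrite -[X in measurable X]setTI; apply: measurable_rV_uncons => //.
  exact: measurableX.
rewrite /lebesgue_rV_step /pushforward -comp_preimage.
rewrite (_ : @rV_uncons n \o @rV_cons n = id); last first.
  by apply/funext => p /=; rewrite rV_consK.
by rewrite preimage_id product_measure1E// lte_mul_pinfty// ge0_fin_numE.
Qed.

HB.instance Definition _ := Measure_isSigmaFinite.Build _ _ _
  lebesgue_rV_step step_sigma_finite.

End step.

Fixpoint lebesgue_rV n : {sigma_finite_measure set 'rV[R]_n -> \bar R} :=
  if n is m.+1 then lebesgue_rV_step (lebesgue_rV m)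
  else \d_(0 : 'rV[R]_0).

End lebesgue_measure_rV.

Section function_spaces.
Variables (R : realType) (d : nat).
Local Notation E := 'rV[R]_d.
Local Notation mu := (lebesgue_rV R d).
Implicit Types (x : E) (u v : E -> R[i]) (phi V : E -> R).

(** The norm [`|x|] of the library on ['rV[R]_d] is the maximum norm. *)
Definition eucl_norm x : R := Num.sqrt (\sum_(i < d) x ord0 i ^+ 2).

Definition eucl_ball x (r : R) : set E := [set y | eucl_norm (y - x) < r].

Definition Linf_loc V : Prop :=
  measurable_fun [set: E] V /\
  forall K : set E, compact K -> V \_ K \in Lfun mu +oo%E.

Definition tends_to_pinfty V : Prop :=
  forall M : R, exists rho : R,
    {ae mu, forall x, rho <= eucl_norm x -> M <= V x}.

Definition cintegral (f : E -> R[i]) : R[i] :=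
  (\int[mu]_x complex.Re (f x)) +i* (\int[mu]_x complex.Im (f x)).

(** Elements of the complex space [L^2(R^d)] are represented by functions;
    identities between them are meant almost everywhere. *)
Definition L2 : set (E -> R[i]) :=
  [set u | (fun x => complex.Re (u x)) \in Lfun mu 2%:E /\
           (fun x => complex.Im (u x)) \in Lfun mu 2%:E].

Definition L2inner u v : R[i] := cintegral (fun x => u x * (v x)^*).

Definition L2norm u : R := Num.sqrt (complex.Re (L2inner u u)).

Definition partial (i : 'I_d) phi : E -> R :=
  fun x => 'D_(delta_mx ord0 i : E) phi x.

Fixpoint Cn (n : nat) phi : Prop :=
  continuous phi /\
  if n is m.+1 then
    forall i : 'I_d,
      (forall x, derivable phi x (delta_mx ord0 i : E)) /\ Cn m (partial i phi)
  else True.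

Definition test_function phi : Prop :=
  (forall n, Cn n phi) /\ compact (closure [set x | phi x != 0]).

Definition laplacian phi : E -> R :=
  fun x => \sum_(i < d) partial i (partial i phi) x.

(** Unbounded operators on [L^2(R^d)] are given by their graphs. *)
Definition operator := (E -> R[i]) -> set (E -> R[i]).
Implicit Types (P S : operator).

Definition dom S : set (E -> R[i]) := [set u | exists f, S u f].

(** A value of [S] at [u]; for a densely defined symmetric [S] it is unique up
    to almost everywhere equality. *)
Definition app S u : E -> R[i] := xget (fun=> 0) (S u).

Definition adjoint S : operator := fun u =>
  [set f | [/\ L2 u, L2 f &
    forall w g, S w g -> L2inner g u = L2inner w f]].

Definition densely_defined S : Prop :=
  dom S `<=` L2 /\
  forall u, L2 u -> forall e : R, 0 < e ->
    exists2 w, dom S w & L2norm (u - w) < e.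

Definition self_adjoint S : Prop :=
  densely_defined S /\ forall u f, S u f <-> adjoint S u f.

(** [S] is the operator [P^(1/2)]: the non-negative self-adjoint operator
    whose square, with its natural domain, is [P]. *)
Definition is_sqrt_operator P S : Prop :=
  [/\ self_adjoint S,
      forall u f, S u f -> 0 <= L2inner f u
    & forall u f, P u f <-> exists2 g, S u g & S g f].

(** The graph of [V - (1/2) Laplacian] on its maximal domain: [u] and [f] are in
    [L^2] and [V u - (1/2) Laplacian u = f] in the sense of distributions.  By
    linearity, real test functions suffice. *)
Definition schrodinger V : operator := fun u =>
  [set f | [/\ L2 u, L2 f &
    forall phi, test_function phi ->
      cintegral (fun x => u x * (V x * phi x - 2^-1 * laplacian phi x)%:C) =
      cintegral (fun x => f x * (phi x)%:C)]].

End function_spaces.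

(** A normed space is given here by a subset [H] of a vector space, the
    equality [eqv] on [H] and the norm [nrm]; they stand for the quotient of
    [H] by [eqv]. *)

Section semigroups.
Variables (R : realType) (X : lmodType R[i]).
Variables (H : set X) (eqv : X -> X -> Prop) (nrm : X -> R).

Definition opnorm (A : X -> X) : \bar R :=
  ereal_sup [set (nrm (A U))%:E | U in [set U | H U /\ nrm U <= 1]].

Definition bounded_linear (A : X -> X) : Prop :=
  [/\ forall U, H U -> H (A U),
      forall (a : R[i]) U W, H U -> H W ->
        eqv (A (a *: U + W)) (a *: A U + A W)
    & (opnorm A < +oo)%E].

Definition C0_semigroup (T : R -> X -> X) : Prop :=
  [/\ forall t, 0 <= t -> bounded_linear (T t),
      forall U, H U -> eqv (T 0 U) U,
      forall s t U, 0 <= s -> 0 <= t -> H U -> eqv (T (s + t) U) (T s (T t U))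
    & forall U, H U -> nrm (T h U - U) @[h --> (0 : R)^'+] --> (0 : R)].

Definition generator (T : R -> X -> X) (U W : X) : Prop :=
  [/\ H U, H W &
    nrm ((h^-1)%:C *: (T h U - U) - W) @[h --> (0 : R)^'+] --> (0 : R)].

End semigroups.

Section damped_wave.
Variables (R : realType) (d : nat).
Local Notation E := 'rV[R]_d.
Local Notation mu := (lebesgue_rV R d).
Local Notation state := ((E -> R[i]) * (E -> R[i]))%type.
Implicit Types (V b : E -> R) (S : operator R d) (U W : state).

(** The energy space and its inner product; [S] stands for [P^(1/2)]. *)
Definition energy_space S : set state := [set U | dom S U.1 /\ L2 U.2].

Definition energy_inner S U W : R[i] :=
  L2inner (app S U.1) (app S W.1) + L2inner U.2 W.2.

Definition energy_norm S U : R := Num.sqrt (complex.Re (energy_inner S U U)).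

Definition state_eq U W : Prop := U.1 = W.1 %[ae mu] /\ U.2 = W.2 %[ae mu].

(** The graph of the operator [(u, v) |-> (v, - P u - b v)] on
    [dom P (+) dom P^(1/2)]. *)
Definition damped_wave_operator V b S U W : Prop :=
  [/\ dom S U.2, energy_space S W &
    exists2 f, schrodinger V U.1 f &
      state_eq W (U.2, fun x => - f x - (b x)%:C * U.2 x)].

(** The square root [S] and the semigroup [T] are uniquely determined, up to
    almost everywhere equality. *)
Definition uniformly_stable V b : Prop :=
  exists (S : operator R d) (T : R -> state -> state),
    [/\ is_sqrt_operator (schrodinger V) S,
        C0_semigroup (energy_space S) state_eq (energy_norm S) T,
        forall U W, generator (energy_space S) (energy_norm S) T U W <->
                    damped_wave_operator V b S U W
      & exists C tau : R, [/\ 0 < C, 0 < tau &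
          forall t, 0 <= t ->
            (opnorm (energy_space S) (energy_norm S) (T t)
               <= (C * expR (- t / tau))%:E)%E]].

Definition kappa : E -> R := fun x =>
  (fine (mu (eucl_ball 0 1)))^-1 * \1_(eucl_ball 0 1) x.

Definition kappa_r (r : R) : E -> R := fun x =>
  (r ^+ d)^-1 * kappa (r^-1 *: x).

Definition convolution (f g : E -> R) : E -> R := fun x =>
  \int[mu]_y (f y * g (x - y)).

End damped_wave.

(* Main.v *)
Require Import Defs.
From mathcomp Require Import all_boot all_order all_algebra.
From mathcomp Require Import all_classical all_reals all_analysis.
From mathcomp Require Import measurable_realfun ess_sup_inf.
From mathcomp Require Import complex ring lra.

(** A uniformly stable semigroup satisfies a resolvent estimate on the imaginary
    axis: |W| <= K |(A_b - i om) W|, with K independent of om.  Test it on the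
    quasimodes W = (w, i om w), w = exp(i lam nu.x) a(x), lam = sqrt 2 om, with a
    an amplitude of class C^2 and compact support.  Then (A_b - i om) W = (0, v)
    with |v|^2 = (Delta a / 2 - V a)^2 + om^2 (sqrt 2 nu.grad a - b a)^2, and
    om -> oo eliminates V:
      int a^2 <= K^2 int (sqrt 2 nu.grad a - b a)^2.
    Apply this to a_s(x) = psi(t / T) chi((x - x0 - t nu) / r), t = nu.x + s, whose
    derivative along nu only falls on psi, and integrate over s in R.  By the
    change of variable s -> t and translation invariance, all the a_s together see
    exactly the time average of b over the ball of radius r moving along the line
    x0 + t nu, while the term in nu.grad a is O(1 / T) and is absorbed by taking T
    large, uniformly in r. *)

Set Implicit Arguments.
Unset Strict Implicit.
Unset Printing Implicit Defensive.

Import Order.TTheory GRing.Theory Num.Theory.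
Import numFieldNormedType.Exports.

Local Open Scope classical_set_scope.
Local Open Scope ring_scope.

(** The quasimode bound is quadratic in [b], while the average to be bounded below is linear in it.
    The square is opened by (p - q)^2 <= 2 p^2 + 2 q^2 and b^2 <= B |b|, with [B] an almost
    everywhere bound. Uniformity in [r] comes from the argument x - x0 - t nu of [chi]: it is
    invariant along [nu], so no derivative of [chi], of size 1 / r, ever enters. The resolvent bound
    avoids vector-valued integrals: a discrete Duhamel sum uses only the difference quotient at time
    0 and the decay of the semigroup. The constant named [K] in the code is the square of the
    operator constant. Elements of L^2 are functions, P^(1/2) is a graph and [app] an unspecified
    value of it. Identities for the semigroup therefore hold only up to energy norm 0, and linearity
    and uniqueness of P^(1/2) have to be drawn from self-adjointness. Amplitudes of class C^2
    suffice, because for them the distributional value of P is the classical one; cubes of positive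
    parts of quadratic polynomials provide them. *)

(** * Translation invariance of Lebesgue measure on row vectors *)

Section lebesgue_rV_theory.
Variable R : realType.
Local Notation leb := (@lebesgue_measure R).

Lemma measurable_addr (c : R) :
  measurable_fun [set: measurableTypeR R] (fun x : measurableTypeR R => x + c : measurableTypeR R).
Proof. exact: measurable_funD. Qed.

(** The image measure under the translation gives half-open intervals their length, and this
    determines Lebesgue measure. *)
Lemma lebesgue_measure_shift (c : R) (A : set (measurableTypeR R)) :
  measurable A -> leb ((fun x => x + c) @^-1` A) = leb A.
Proof.
move=> mA; apply/esym.
pose m' := measure_function_pushforward__canonical__measure_function_Measure leb (measurable_addr
    c).
apply: (@lebesgue_measure_unique R m') => // _ [[a b]] _ <-.
rewrite /= /pushforward (_ : (fun x => x + c) @^-1` _ = `](a - c), (b - c)]%classic); last first.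
  by apply/seteqP; split => x /=; rewrite !in_itv /= ltrBlDr lerBrDr.
rewrite !lebesgue_measure_itv /= !lte_fin ltrD2r.
by case: ifP => // _; congr EFin; lra.
Qed.

Lemma measurable_shift_rV n (v : 'rV[R]_n) : measurable_fun [set: 'rV[R]_n] (fun x => x + v).
Proof.
apply: measurable_fun_rV => i.
have -> : rV_coord i \o (fun x : 'rV[R]_n => x + v) = (fun x => rV_coord i x + v ord0 i).
  by apply/funext => x /=; rewrite /rV_coord mxE.
by apply: (@measurable_funD _ 'rV[R]_n) => //; exact: measurable_rV_coord.
Qed.

Lemma rV_unconsK n : cancel (@rV_uncons R n) (@rV_cons R n).
Proof.
move=> x; apply/rowP => i; rewrite /rV_cons /rV_uncons /=.
case: (unliftP ord0 i) => [j ->|->].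
  rewrite (_ : lift ord0 j = rshift 1 j); last exact/val_inj.
  by rewrite (@row_mxEr _ 1 1 n) mxE; congr (x _ _); exact/val_inj.
rewrite (_ : ord0 = lshift n (ord0 : 'I_1)); last exact/val_inj.
by rewrite (@row_mxEl _ 1 1 n) mxE eqxx mulr1n; congr (x _ _); exact/val_inj.
Qed.

Lemma rV_uncons_inj n : injective (@rV_uncons R n).
Proof. exact: can_inj (@rV_unconsK n). Qed.

(** Induction on the dimension: read through [rV_cons], the translation acts separately on the first
    coordinate and on the others, and a measure with the product values on rectangles is the product
    measure. *)
Lemma lebesgue_rV_shift n (v : 'rV[R]_n) (A : set 'rV[R]_n) :
  measurable A -> lebesgue_rV R n ((fun x => x + v) @^-1` A) = lebesgue_rV R n A.
Proof.
elim: n v A => [|n IH] v A mA.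
  by congr (lebesgue_rV R 0 _); apply/seteqP; split => x /=; rewrite (_ : x + v = x) //;
      apply/rowP => -[].
rewrite /= /lebesgue_rV_step /pushforward.
pose c := (rV_uncons v).1; pose w := (rV_uncons v).2.
pose sh := fun p : measurableTypeR R * 'rV[R]_n => ((p.1 + c : measurableTypeR R), p.2 + w).
have msh : measurable_fun setT sh.
  apply: measurable_fun_pair.
    apply: (measurableT_comp (measurable_addr c)); exact: measurable_fst.
  apply: (measurableT_comp (measurable_shift_rV w)); exact: measurable_snd.
have mB : measurable (@rV_cons R n @^-1` A).
  by rewrite -[X in measurable X]setTI; exact: measurable_rV_cons.
have shE p : rV_cons p + v = rV_cons (sh p).
  apply: rV_uncons_inj; rewrite rV_consK [RHS]surjective_pairing /=.
  rewrite -[in RHS](rV_consK p) /sh /c /w /rV_uncons /=; congr pair; first by rewrite mxE.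
  by apply/rowP => j; rewrite !mxE.
have -> : @rV_cons R n @^-1` ((fun x => x + v) @^-1` A) = sh @^-1` (@rV_cons R n @^-1` A).
  by apply/seteqP; split => p /=; rewrite shE.
pose m' := measure_function_pushforward__canonical__measure_function_Measure (leb \x lebesgue_rV
    R n)%E msh.
apply/esym; apply: (@product_measure_unique _ _ _ _ _ _ _ m') => // B C mB' mC.
rewrite /= /pushforward -(lebesgue_measure_shift c mB') -(IH w C mC).
rewrite -product_measure1E //.
  rewrite -[X in measurable X]setTI; exact: measurable_addr.
rewrite -[X in measurable X]setTI; exact: measurable_shift_rV.
Qed.

End lebesgue_rV_theory.

(** * Cubes, and measurability of continuous functions *)

Section cubes_and_continuity.
Variable R : realType.
Local Notation leb := (@lebesgue_measure R).

Lemma le_coord_norm n (x : 'rV[R]_n) i : `|x ord0 i| <= `|x|.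
Proof.
rewrite [leRHS]/Num.norm /= mx_normrE.
by apply/bigmax_geP; right; exists (ord0, i).
Qed.

Lemma norm_rV_le n (x : 'rV[R]_n) M : 0 <= M -> (forall i, `|x ord0 i| <= M) -> `|x| <= M.
Proof.
move=> M0 xM; rewrite [leLHS]/Num.norm /= mx_normrE.
by apply/bigmax_leP; split => // -[i j] _ /=; rewrite ord1.
Qed.

(** Supports and volumes are controlled by cubes rather than Euclidean balls, since the measure of a
    cube follows coordinate by coordinate. *)
Definition cube n (r : R) : set 'rV[R]_n := [set x | forall i, `|x ord0 i| < r].

Arguments cube : clear implicits.

Lemma measurable_rV_preimage n (i : 'I_n) (B : set R) : measurable B -> measurable [set x :
    'rV[R]_n | B (x ord0 i)].
Proof.
move=> mB; rewrite -[X in measurable X]setTI.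
exact: (@measurable_rV_coord R n i measurableT B).
Qed.

Lemma measurable_forall_rV n (B : 'I_n -> set 'rV[R]_n) : (forall i, measurable (B i)) ->
  measurable [set x | forall i, B i x].
Proof.
move=> mB.
rewrite (_ : mkset _ = \bigcap_(i in [set: 'I_n]) B i).
  by apply: fin_bigcap_measurable => //; exact: finite_finset.
by apply/seteqP; split => x /= h i; [move=> _; exact: h | exact: h].
Qed.

Lemma measurable_cube n (r : R) : measurable (cube n r).
Proof.
apply: (measurable_forall_rV (B := fun i => [set x : 'rV[R]_n | `|x ord0 i| < r])) => i.
have -> : [set x : 'rV[R]_n | `|x ord0 i| < r] = [set x | `]-r, r[%classic (x ord0 i)].
  by apply/seteqP; split => x /=; rewrite in_itv /= ltr_norml.
by apply: measurable_rV_preimage; exact: measurable_itv.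
Qed.

Lemma lebesgue_cube n (r : R) : 0 < r -> lebesgue_rV R n (cube n r) = ((2 * r) ^+ n)%:E.
Proof.
move=> r0; elim: n => [|n IH].
  rewrite /= expr0 diracE mem_set//=.
  by move=> i; have := ltn_ord i; rewrite ltn0.
rewrite /= /lebesgue_rV_step /pushforward.
have -> : @rV_cons R n @^-1` cube n.+1 r = `]-r, r[%classic `*` cube n r.
  have E (p : measurableTypeR R * 'rV[R]_n) : rV_cons p ord0 ord0 = p.1 /\ forall j, rV_cons p
      ord0 (lift ord0 j) = p.2 ord0 j.
    have E1 := congr1 fst (rV_consK p); have /rowP E2 := congr1 snd (rV_consK p).
    split=> [|j]; first exact: E1.
    by have := E2 j; rewrite /= mxE.
  apply/seteqP; split => -[a v] /= h.
    have [E1 E2] := E (a, v).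
    split; first by have := h ord0; rewrite E1 in_itv /= ltr_norml.
    by move=> j; have := h (lift ord0 j); rewrite E2.
  move: h => [+ h2]; rewrite in_itv /= -ltr_norml => h1.
  have [E1 E2] := E (a, v).
  by move=> i; case: (unliftP ord0 i) => [j ->|->]; rewrite ?E1 ?E2.
rewrite product_measure1E //; last exact: measurable_cube.
rewrite IH [X in (X * _)%E](_ : _ = (2 * r)%:E); first by rewrite -EFinM exprS.
rewrite [LHS](lebesgue_measure_itv `]-r, r[) /= lte_fin.
by rewrite ifT; [congr EFin|]; lra.
Qed.

(* [f] is the pointwise limit of its compositions with rounding to the grid of
   mesh [1 / k.+1], which take countably many values. *)
Lemma continuous_measurable_rV n (f : 'rV[R]_n -> R) : continuous f -> measurable_fun [set:
    'rV[R]_n] f.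
Proof.
move=> cf.
pose g k (z : 'rV[int]_n) : 'rV[R]_n := \row_i ((z ord0 i)%:~R / k.+1%:R).
pose rd k (x : 'rV[R]_n) : 'rV[int]_n := \row_i Num.floor (x ord0 i * k.+1%:R).
apply: (measurable_fun_cvg (h := fun k x => f (g k (rd k x)))) => //.
  move=> k _ B mB; rewrite setTI.
  have -> : (fun x => f (g k (rd k x))) @^-1` B =
      \bigcup_(z : 'rV[int]_n) (if f (g k z) \in B then [set x | rd k x = z] else set0).
    apply/seteqP; split => x /=.
      by move=> Bx; exists (rd k x) => //; rewrite ifT //; rewrite inE.
    by move=> [z _]; case: ifPn => // /set_mem ? /= ->.
  apply: countable_bigcupT_measurable; first exact: countableP.
  move=> z; case: ifP => // _.
  have -> : [set x | rd k x = z] = [set x | forall i, (fun y => Num.floor (y * k.+1%:R) = z ord0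
      i) (x ord0 i)].
    apply/seteqP; split => x /=.
      by move=> <- i; rewrite mxE.
    by move=> h; apply/rowP => i; rewrite mxE.
  apply: (measurable_forall_rV (B := fun i => [set x : 'rV[R]_n | Num.floor (x ord0 i * k.+1%:R)
      = z ord0 i])) => i.
  apply: (measurable_rV_preimage i (B := [set y | Num.floor (y * k.+1%:R) = z ord0 i])).
  have -> : [set y : R | Num.floor (y * k.+1%:R) = z ord0 i] = `[(z ord0 i)%:~R / k.+1%:R, (z
      ord0 i + 1)%:~R / k.+1%:R[%classic.
    apply/seteqP; split => y /=; rewrite in_itv /=.
      move=> <-; have := floor_itv (y * k.+1%:R).
      by rewrite ler_pdivrMr ?ltr0n // ltr_pdivlMr ?ltr0n.
    by rewrite ler_pdivrMr ?ltr0n // ltr_pdivlMr ?ltr0n // => /floor_def.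
  exact: measurable_itv.
move=> x _.
apply: (cvg_comp (fun k => g k (rd k x)) f); last exact: cf.
apply/cvgrPdist_le => e e0; near=> k.
apply: norm_rV_le => [|i]; first exact: ltW.
rewrite !mxE.
have kp : 0 < k.+1%:R :> R by rewrite ltr0n.
have /andP[h1 h2] := floor_itv (x ord0 i * k.+1%:R).
have ke : k.+1%:R^-1 <= e.
  apply: ltW; near: k; exact: (near_infty_natSinv_lt (PosNum e0)).
rewrite ger0_norm; last by rewrite subr_ge0 ler_pdivrMr.
apply: le_trans ke.
rewrite lerBlDr -[X in X + _]mul1r -mulrDl ler_pdivlMr // addrC.
by apply: ltW; rewrite intrD in h2.
Unshelve. all: by end_near. Qed.

End cubes_and_continuity.
Arguments cube {R} n r.

(** * Invariance of integrals, and functions of bounded support *)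

Section integral_rV.
Variable R : realType.
Local Notation leb := (@lebesgue_measure R).

(** For nonnegative functions this is the change of variables through the pushforward measure;
    positive and negative parts give the general case. *)
Lemma integral_invariant d (T : measurableType d) (mu : {measure set T -> \bar R}) (phi : T -> T)
    (f : T -> \bar R) :
  measurable_fun setT phi -> (forall A, measurable A -> mu (phi @^-1` A) = mu A) ->
  measurable_fun setT f ->
  (\int[mu]_x f (phi x) = \int[mu]_x f x)%E.
Proof.
move=> mphi inv mf.
have ge0 g : measurable_fun setT g -> (forall x, 0 <= g x)%E -> (\int[mu]_x g (phi x) =
    \int[mu]_x g x)%E.
  move=> mg g0; rewrite -[LHS](@ge0_integral_pushforward _ _ _ _ _ _ mphi mu setT g) //.
  by apply: eq_measure_integral => A mA _; exact: inv.
rewrite -[fun x => f (phi x)]/(f \o phi) integralE [RHS]integralE.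
under [X in (X - _)%E]eq_integral do rewrite funepos_comp/=.
under [X in (_ - X)%E]eq_integral do rewrite funeneg_comp/=.
congr (_ - _)%E.
  apply: (ge0 (f^\+)%E) => //; exact: measurable_funepos.
apply: (ge0 (f^\-)%E) => //; exact: measurable_funeneg.
Qed.

Lemma integral_shift (c : R) (f : R -> \bar R) :
  measurable_fun [set: measurableTypeR R] (f : measurableTypeR R -> \bar R) ->
  (\int[leb]_x f (x + c)%R = \int[leb]_x f x)%E.
Proof.
move=> mf; apply: (@integral_invariant _ _ leb (fun x : measurableTypeR R => x + c :
    measurableTypeR R)) => //.
  exact: measurable_addr.
exact: lebesgue_measure_shift.
Qed.

Lemma integral_shift_rV n (v : 'rV[R]_n) (f : 'rV[R]_n -> \bar R) :
  measurable_fun setT f ->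
  (\int[lebesgue_rV R n]_x f (x + v)%R = \int[lebesgue_rV R n]_x f x)%E.
Proof.
move=> mf; apply: (@integral_invariant _ _ (lebesgue_rV R n) (fun x => x + v)) => //.
  exact: measurable_shift_rV.
exact: lebesgue_rV_shift.
Qed.

Definition bounded_support n (f : 'rV[R]_n -> R) := exists2 r : R, 0 < r & forall x, ~ cube n r x
    -> f x = 0.

Lemma bounded_support_integrable n (f : 'rV[R]_n -> R) (M : R) : measurable_fun setT f ->
    bounded_support f -> (forall x, `|f x| <= M) ->
  (lebesgue_rV R n).-integrable setT (EFin \o f).
Proof.
move=> mf [r r0 fr] fM.
have mc : measurable (cube n r) by exact: measurable_cube.
have -> : EFin \o f = ((EFin \o f) \_ (cube n r))%E.
  apply/funext => x; rewrite /patch; case: ifPn => //.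
  by move/negP => h; rewrite /= fr // => h'; apply: h; rewrite inE.
apply/(integrable_mkcond _ mc).
apply: measurable_bounded_integrable => //.
- by rewrite [X in (X < _)%E](lebesgue_cube n r0) ltry.
- exact: measurable_funTS.
- by exists M; split; [exact: num_real | move=> m Mm x _; apply: le_trans (ltW Mm)].
Qed.

Lemma compact_closed_cube n (r : R) : compact [set x : 'rV[R]_n | forall i, `|x ord0 i| <= r].
Proof.
have : compact [set x : 'rV[R]_n | forall i, `[-r, r]%classic (x ord0 i)].
  by apply: (@rV_compact R n (fun=> `[-r, r]%classic)) => _; exact: segment_compact.
congr compact; apply/seteqP; split => x /= h i; have := h i; by rewrite in_itv /= ler_norml.
Qed.

Lemma continuous_bounded_support_bounded n (f : 'rV[R]_n -> R) : continuous f -> bounded_support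
    f -> exists M, forall x, `|f x| <= M.
Proof.
move=> cf [r r0 fr].
have /compact_bounded[M [_ hM]] := continuous_compact (continuous_subspaceT cf)
    (@compact_closed_cube n r).
(* [compact_bounded] gives a bound for every real strictly above [M], hence the shift by 1. *)
exists (`|M| + 1) => x.
have [xr|xr] := pselect (cube n r x); last by rewrite fr // normr0 addr_ge0.
apply: hM; first by rewrite ltr_pwDr // ler_norm.
by exists x => // i; exact: ltW.
Qed.

Lemma continuous_bounded_support_integrable n (f : 'rV[R]_n -> R) : continuous f ->
    bounded_support f ->
  (lebesgue_rV R n).-integrable setT (EFin \o f).
Proof.
move=> cf sf; have [M fM] := continuous_bounded_support_bounded cf sf.
exact: bounded_support_integrable (continuous_measurable_rV cf) sf fM.
Qed.

End integral_rV.

(** * Directional derivatives as derivatives along lines *)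

Section lines.
Variables (R : realType) (n : nat).
Local Notation E := 'rV[R]_n.

(** Both sides have literally the same difference quotients. This is the passage to one-variable
    results such as the mean value theorem. *)
Lemma is_derive_lineP (F : E -> R) (x v : E) (s df : R) :
  is_derive (x + s *: v) v F df <-> is_derive s (1:R) (fun t : R => F (x + t *: v)) df.
Proof.
have eq : (fun h : R => h^-1 *: (((fun t : R => F (x + t *: v)) \o shift s) (h *: (1:R)) - F (x +
    s *: v))) =
          (fun h : R => h^-1 *: ((F \o shift (x + s *: v)) (h *: v) - F (x + s *: v))).
  apply/funext => h /=; congr (_ *: (F _ - _)).
  by rewrite [h *: 1]mulr1 scalerDl addrCA.
split => -[dF DF].
  split; first by rewrite /derivable eq.
  by rewrite /derive eq.
split; first by move: dF; rewrite /derivable eq.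
by move: DF; rewrite /derive eq.
Qed.

(** Restricting [p] to the line through [x] along [v] reduces this to the one-variable chain rule,
    so a directional derivative of [p] is enough. *)
Lemma is_derive_comp1 (p : E -> R) (g : R -> R) (x v : E) (dp dg : R) :
  is_derive x v p dp -> is_derive (p x) (1:R) g dg -> is_derive x v (g \o p) (dp * dg).
Proof.
move=> hp hg.
have hx : x = x + 0 *: v by rewrite scale0r addr0.
rewrite hx in hp *.
apply/is_derive_lineP.
have hp' : is_derive (0:R) (1:R) (fun t : R => p (x + t *: v)) dp by apply/is_derive_lineP.
rewrite mulrC.
by apply: (@is_derive1_comp R g (fun t : R => p (x + t *: v)) 0 dg dp); rewrite -?hx.
Qed.

End lines.

(** * Vanishing of the integral of a derivative *)

Section integration_by_parts.
Variables (R : realType) (n : nat).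
Local Notation E := 'rV[R]_n.
Local Notation mu := (lebesgue_rV R n).

(** Outside the cube enlarged by [|v| + 1], the whole segment x + t v with |t| <= 1 avoids the
    original cube, so [F] is zero near [x] along the line. *)
Lemma bounded_support_derive (F : E -> R) (v : E) : bounded_support F -> bounded_support (fun x
    => 'D_v F x).
Proof.
move=> [r r0 Fr]; exists (r + `|v| + 1) => [|x]; first by rewrite ltr_wpDl // addr_ge0 // ltW.
move=> /existsNP[i /negP]; rewrite -leNgt => xi.
have -> : 'D_v F x = 'D_0 F x; last by rewrite derive0.
have h0 : is_derive (0:R) (1:R) (fun t : R => F (x + t *: v)) 0.
  apply: (@near_eq_is_derive R R R (cst (0:R))).
  near=> t; rewrite /= Fr // => /(_ i); apply/negP; rewrite -leNgt !mxE.
  have t1 : `|t| <= 1.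
    near: t; apply: (@nbhs0_le R R) => //.
  have := ler_normB (x ord0 i + t * v ord0 i) (t * v ord0 i); rewrite addrK => h.
  have h2 : `|t * v ord0 i| <= `|v|.
    rewrite normrM -[leRHS]mul1r; apply: ler_pM => //; exact: le_coord_norm.
  by rewrite -(lerD2r `|v|); apply: (le_trans _ (le_trans h _)); [apply: le_trans xi; rewrite
      lerDl | rewrite lerD2l].
have : is_derive (x + 0 *: v) v F 0 by apply/is_derive_lineP.
by rewrite scale0r addr0 derive0 => -[].
Unshelve. all: by end_near. Qed.

Lemma derive_increment_le (F : E -> R) (v : E) (M : R) (x : E) (t : R) : (forall x : E, derivable
    F x v) -> (forall x, `|'D_v F x| <= M) ->
  `|F (x + t *: v) - F x| <= `|t| * M.
Proof.
move=> dF FM.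
pose G s := F (x + s *: v).
have dG (s : R) : is_derive s (1:R) G ('D_v F (x + s *: v)).
  by apply/is_derive_lineP; apply: derivableP.
have cG : continuous G.
  move=> s; apply: differentiable_continuous; apply/derivable1_diffP; by case: (dG s).
have -> : F x = G 0 by rewrite /G scale0r addr0.
rewrite -/(G t).
have key a b : a <= b -> `|G b - G a| <= (b - a) * M.
  move=> ab; have [c _ ->] := @MVT_segment R G (fun s => 'D_v F (x + s *: v)) a b ab (fun s _ =>
      dG s) (continuous_subspaceT cG).
  by rewrite normrM (@ger0_norm _ (b - a)) ?subr_ge0 // mulrC ler_wpM2l // subr_ge0.
have [t0|t0] := leP 0 t.
  by have := key _ _ t0; rewrite subr0 (ger0_norm t0).
by have := key _ _ (ltW t0); rewrite sub0r distrC (ltr0_norm t0).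
Qed.

(* Difference quotients of [F] have integral zero by translation invariance. *)
Lemma integral_derive0 (F : E -> R) (v : E) : continuous F -> (forall x : E, derivable F x v) ->
  continuous (fun x => 'D_v F x) -> bounded_support F -> \int[mu]_x ('D_v F x) = 0.
Proof.
move=> cF dF cD sF.
have [M FM] := continuous_bounded_support_bounded cD (bounded_support_derive v sF).
have M0 : 0 <= M by apply: le_trans (FM 0).
have mF := continuous_measurable_rV cF.
pose h (k : nat) : R := k.+1%:R^-1.
pose g k x := (h k)^-1 * (F (x + h k *: v) - F x).
have mg k : measurable_fun setT (g k).
  apply: measurable_funM => //; apply: measurable_funB => //.
  apply: measurableT_comp => //; exact: measurable_shift_rV.
(* The steps [h k] are at most 1, so all the quotients [g k] vanish outside one cube, of half-side
   [r'], on which [M] dominates them. *)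
have [r r0 Fr] := sF.
pose r' := r + `|v| + 1.
have r'0 : 0 < r' by rewrite /r' ltr_wpDl // addr_ge0 // ltW.
have mc : measurable (cube n r') by exact: measurable_cube.
have h0 k : 0 < h k by rewrite invr_gt0 ltr0n.
have h1 k : h k <= 1 by rewrite invf_le1 ?ltr0n // ler1n.
have hF k x : ~ cube n r' x -> F (x + h k *: v) = 0.
  move=> /existsNP[i /negP]; rewrite -leNgt => xi.
  apply: Fr => /(_ i); apply/negP; rewrite -leNgt !mxE.
  have := ler_normB (x ord0 i + h k * v ord0 i) (h k * v ord0 i); rewrite addrK => h3.
  have h2 : `|h k * v ord0 i| <= `|v|.
    rewrite normrM -[leRHS]mul1r ger0_norm ?(ltW (h0 k)) //; apply: ler_pM => //; [exact: ltW |
        exact: le_coord_norm].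
  by rewrite -(lerD2r `|v|); apply: (le_trans _ (le_trans h3 _)); [apply: le_trans xi; rewrite
      /r' lerDl | rewrite lerD2l].
have hF' x : ~ cube n r' x -> F x = 0.
  move=> nx; apply: Fr => xr; apply: nx => i; apply: lt_trans (xr i) _.
  by rewrite /r' -addrA ltrDl ltr_wpDl.
have [|||||_ _ cv] := @dominated_convergence _ _ _ mu setT measurableT (fun k x => (g k x)%:E)
    (fun x => ('D_v F x)%:E)
   (fun x => (M * \1_(cube n r') x)%:E).
- by move=> k; apply/measurable_EFinP.
- by apply/measurable_EFinP; exact: continuous_measurable_rV.
- apply: aeW => x _ /=; apply: cvg_EFin; first by near=> k.
  rewrite (_ : fine \o _ = (fun t => t^-1 *: ((F \o shift x) (t *: v) - F x)) \o h); last first.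
    by apply/funext => k /=; rewrite /g (addrC x).
  have /cvgr_dnbhsP := dF x; apply; split; first by move=> k; rewrite gt_eqF.
  exact: cvg_harmonic.
- have : mu.-integrable setT (EFin \o (fun x => M * \1_(cube n r') x)).
    apply: (@bounded_support_integrable _ _ _ M).
    + by apply: measurable_funM => //; exact: measurable_indic.
    + exists r' => // x nx; rewrite indicE memNset // mulr0 //.
    + move=> x; rewrite normrM (ger0_norm M0) -[leRHS]mulr1 ler_wpM2l // indicE; case: (_ \in _);
        by rewrite ?normr1 ?normr0.
  by [].
- apply: aeW => x k _ /=; rewrite lee_fin indicE.
  have [xr|xr] := pselect (cube n r' x); last first.
    by rewrite /g hF // hF' // subrr mulr0 normr0 memNset // mulr0.
  rewrite mem_set // mulr1 /g normrM normfV (ger0_norm (ltW (h0 k))) ler_pdivrMl //.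
  by have := derive_increment_le x (h k) dF FM; rewrite (ger0_norm (ltW (h0 k))).
have I0 k : (\int[mu]_x (g k x)%:E = 0)%E.
  rewrite /g; under eq_integral do rewrite EFinM.
  have iF := continuous_bounded_support_integrable cF sF.
  have iF' : mu.-integrable setT (EFin \o (fun x => F (x + h k *: v))).
    have [M' FM'] := continuous_bounded_support_bounded cF sF.
    apply: (@bounded_support_integrable _ _ _ M').
    - apply: measurableT_comp => //; exact: measurable_shift_rV.
    - by exists r' => // x nx; exact: hF.
    - by move=> x.
  rewrite integralZl //; last first.
    under eq_fun do rewrite EFinB.
    exact: integrableB.
  under eq_integral do rewrite EFinB.
  rewrite integralB_EFin // (integral_shift_rV (h k *: v) (f := EFin \o F)); last
      exact/measurable_EFinP.
  by rewrite subee ?mule0 //; exact: integrable_fin_num.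
rewrite /Rintegral.
have -> : (\int[mu]_x ('D_v F x)%:E = 0)%E.
  rewrite -(cvg_lim _ cv) //.
  rewrite (_ : (fun k => _) = cst 0%E); last by apply/funext => k; exact: I0.
  exact: lim_cst.
by [].
Unshelve. all: by end_near. Qed.

End integration_by_parts.

(** * Functions of class C^n and Green's identity *)

Section smooth.
Variables (R : realType) (d : nat).
Local Notation E := 'rV[R]_d.
Local Notation mu := (lebesgue_rV R d).
Local Notation e_ i := (delta_mx ord0 i : 'rV[R]_d).
Implicit Types (f g p : E -> R).

Lemma continuous_add f g : continuous f -> continuous g -> continuous (fun x => f x + g x).
Proof. by move=> cf cg x; exact: cvgD (cf x) (cg x). Qed.

Lemma continuous_mul f g : continuous f -> continuous g -> continuous (fun x => f x * g x).
Proof. by move=> cf cg x; exact: cvgM (cf x) (cg x). Qed.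

Lemma Cn_continuous n f : Cn n f -> continuous f.
Proof. by case: n => [|n] []. Qed.

Lemma Cn_derivable n f i x : Cn n.+1 f -> derivable f x (e_ i).
Proof. by case=> _ /(_ i)[]. Qed.

Lemma Cn_partial n f i : Cn n.+1 f -> Cn n (partial i f).
Proof. by case=> _ /(_ i)[]. Qed.

Lemma Cn_is_derive n f i x : Cn n.+1 f -> is_derive x (e_ i) f (partial i f x).
Proof. by move=> Cf; apply: derivableP; exact: Cn_derivable Cf. Qed.

Lemma partial_val f df i x : is_derive x (e_ i) f df -> partial i f x = df.
Proof. by move=> [_ <-]. Qed.

(** Supplying formulas [df] for the partial derivatives lets the inductions on the order run on
    explicit functions. *)
Lemma Cn_intro n f (df : 'I_d -> E -> R) : continuous f ->
  (forall i x, is_derive x (e_ i) f (df i x)) -> (forall i, Cn n (df i)) -> Cn n.+1 f.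
Proof.
move=> cf Df Cdf; split=> // i; split; first by move=> x; case: (Df i x).
by have -> : partial i f = df i by apply/funext => x; exact: partial_val.
Qed.

Lemma CnS n f : Cn n.+1 f -> Cn n f.
Proof.
elim: n f => [|n IH] f [cf Cf]; split=> // i.
by have [df Cdf] := Cf i; split => //; exact: IH.
Qed.

Lemma Cn_cst n (c : R) : Cn n (fun _ : E => c).
Proof.
elim: n c => [|n IH] c; first by split=> //; exact: cst_continuous.
apply: (@Cn_intro _ _ (fun _ _ => 0)) => //; exact: cst_continuous.
Qed.

Lemma CnD n f g : Cn n f -> Cn n g -> Cn n (fun x => f x + g x).
Proof.
elim: n f g => [|n IH] f g Cf Cg.
  by split=> //; apply: continuous_add; [exact: Cn_continuous Cf | exact: Cn_continuous Cg].
apply: (@Cn_intro _ _ (fun i x => partial i f x + partial i g x)).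
- by apply: continuous_add; [exact: Cn_continuous Cf | exact: Cn_continuous Cg].
- move=> i x; have hf := Cn_is_derive i x Cf; have hg := Cn_is_derive i x Cg.
  exact: is_deriveD.
- by move=> i; apply: IH; exact: Cn_partial.
Qed.

Lemma CnM n f g : Cn n f -> Cn n g -> Cn n (fun x => f x * g x).
Proof.
elim: n f g => [|n IH] f g Cf Cg.
  by split=> //; apply: continuous_mul; [exact: Cn_continuous Cf | exact: Cn_continuous Cg].
apply: (@Cn_intro _ _ (fun i x => f x * partial i g x + g x * partial i f x)).
- by apply: continuous_mul; [exact: Cn_continuous Cf | exact: Cn_continuous Cg].
- move=> i x; have hf := Cn_is_derive i x Cf; have hg := Cn_is_derive i x Cg.
  exact: is_deriveM.
- by move=> i; apply: CnD; apply: IH; [exact: CnS | exact: Cn_partial | exact: CnS | exact: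
    Cn_partial].
Qed.

Lemma CnZ n (c : R) f : Cn n f -> Cn n (fun x => c * f x).
Proof. by move=> Cf; apply: CnM => //; exact: Cn_cst. Qed.

Lemma Cn_sum n (I : Type) (r : seq I) (F : I -> E -> R) : (forall i, Cn n (F i)) ->
  Cn n (fun x => \sum_(i <- r) F i x).
Proof.
move=> CF; elim: r => [|i r IH].
  by under eq_fun do rewrite big_nil; exact: Cn_cst.
by under eq_fun do rewrite big_cons; exact: CnD.
Qed.

Lemma is_derive_coord (j : 'I_d) (x v : E) : is_derive x v (fun y : E => y ord0 j) (v ord0 j).
Proof.
rewrite [X in is_derive X](_ : x = x + 0 *: v); last by rewrite scale0r addr0.
apply/is_derive_lineP.
under eq_fun do rewrite !mxE.
have h1 : is_derive (0:R) (1:R) (fun t : R => t * v ord0 j) (v ord0 j).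
  have h2 : is_derive (0:R) (1:R) (v ord0 j \*: (id : R -> R)) (v ord0 j *: 1) by exact: is_deriveZ.
  by move: h2; rewrite [_ *: 1]mulr1; congr is_derive; apply/funext => t; rewrite /= mulrC.
have h3 : is_derive (0:R) (1:R) (fun t : R => x ord0 j) 0 by exact: is_derive_cst.
have h : is_derive (0:R) (1:R) (fun t : R => x ord0 j + t * v ord0 j) (0 + v ord0 j) by exact:
    is_deriveD.
by move: h; rewrite add0r.
Qed.

Lemma Cn_coord n (j : 'I_d) : Cn n (fun x : E => x ord0 j).
Proof.
have c : continuous (fun x : E => x ord0 j) by exact: coord_continuous.
case: n => [|n]; first by split.
apply: (@Cn_intro _ _ (fun i _ => e_ i ord0 j)) => //.
- by move=> i x; exact: is_derive_coord.
- by move=> i; exact: Cn_cst.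
Qed.

(** The outer function comes with the sequence [g] of its successive derivatives, which the
    induction shifts. Differentiability is asked only below rank [n], so functions of finite
    smoothness such as powers of a positive part qualify. *)
Lemma Cn_comp n (g : nat -> R -> R) p :
  (forall k, continuous (g k)) ->
  (forall k u, (k < n)%N -> is_derive u (1:R) (g k) (g k.+1 u)) ->
  Cn n p -> Cn n (g 0%N \o p).
Proof.
elim: n g p => [|n IH] g p cg dg Cp.
  by split => // x; apply: continuous_comp; [exact: (Cn_continuous Cp) | exact: cg].
apply: (@Cn_intro _ _ (fun i x => partial i p x * g 1%N (p x))).
- by move=> x; apply: continuous_comp; [exact: (Cn_continuous Cp) | exact: cg].
- move=> i x; apply: is_derive_comp1; [exact: Cn_is_derive Cp | exact: dg].
- move=> i; apply: CnM; first exact: Cn_partial.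
  apply: (IH (fun k => g k.+1)) => //; first by move=> k u kn; exact: dg.
  exact: CnS.
Qed.

Lemma bounded_supportMl f g : bounded_support f -> bounded_support (fun x => f x * g x).
Proof. by move=> [r r0 h]; exists r => // x /h ->; rewrite mul0r. Qed.

Lemma bounded_supportMr f g : bounded_support g -> bounded_support (fun x => f x * g x).
Proof. by move=> [r r0 h]; exists r => // x /h ->; rewrite mulr0. Qed.

Lemma bounded_support_sum (I : Type) (r : seq I) (F : I -> E -> R) : (forall i, bounded_support
    (F i)) ->
  bounded_support (fun x => \sum_(i <- r) F i x).
Proof.
move=> sF; elim: r => [|i r [r1 r10 h1]]; first by exists 1 => // x _; rewrite big_nil.
have [r2 r20 h2] := sF i.
exists (Num.max r1 r2) => [|x nx]; first by rewrite lt_max r10.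
rewrite big_cons h1 ?addr0; last first.
  by move=> xr; apply: nx => j; apply: lt_le_trans (xr j) _; rewrite le_max lexx.
by apply: h2 => xr; apply: nx => j; apply: lt_le_trans (xr j) _; rewrite le_max lexx orbT.
Qed.

Lemma Rintegral_by_parts f g i : Cn 1 f -> Cn 1 g -> bounded_support f ->
  \int[mu]_x (f x * partial i g x) = - \int[mu]_x (partial i f x * g x).
Proof.
move=> Cf Cg sf.
have cf := Cn_continuous Cf; have cg := Cn_continuous Cg.
have cpf := Cn_continuous (Cn_partial i Cf); have cpg := Cn_continuous (Cn_partial i Cg).
have CF := CnM Cf Cg.
have DF x : partial i (fun x => f x * g x) x = f x * partial i g x + partial i f x * g x.
  rewrite (mulrC (partial i f x)).
  have hf := Cn_is_derive i x Cf; have hg := Cn_is_derive i x Cg.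
  by apply: partial_val; exact: is_deriveM.
have I0 : \int[mu]_x (partial i (fun x => f x * g x) x) = 0.
  apply: integral_derive0.
  - exact: Cn_continuous CF.
  - by move=> x; exact: Cn_derivable CF.
  - exact: Cn_continuous (Cn_partial i CF).
  - exact: bounded_supportMl.
move: I0; under eq_Rintegral do rewrite DF.
rewrite RintegralD //.
- by move/eqP; rewrite addr_eq0 => /eqP.
- apply: continuous_bounded_support_integrable; last exact: bounded_supportMl.
  by apply: continuous_mul; [exact: cf | exact: cpg].
- apply: continuous_bounded_support_integrable; last by apply: bounded_supportMl; exact:
    bounded_support_derive.
  by apply: continuous_mul; [exact: cpf | exact: cg].
Qed.

(** Integrability is carried along in the conclusion because additivity of the integral asks for it
    at each step. *)
Lemma Rintegral_sum (I : Type) (r : seq I) (F : I -> E -> R) :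
  (forall i, mu.-integrable setT (EFin \o F i)) ->
  \int[mu]_x (\sum_(i <- r) F i x) = \sum_(i <- r) \int[mu]_x F i x /\
  mu.-integrable setT (EFin \o (fun x => \sum_(i <- r) F i x)).
Proof.
move=> iF; elim: r => [|i r [IH1 IH2]].
  rewrite big_nil; under eq_Rintegral do rewrite big_nil.
  split; first by rewrite Rintegral_cst // mul0r.
  rewrite (_ : EFin \o _ = cst 0%E); first exact: integrable0.
  by apply/funext => x /=; rewrite big_nil.
have E : (fun x => \sum_(j <- i :: r) F j x) = (fun x => F i x + \sum_(j <- r) F j x).
  by apply/funext => x; rewrite big_cons.
rewrite E big_cons RintegralD // IH1; split => //.
exact: (integrableD measurableT (iF i) IH2).
Qed.

(** Two integrations by parts in each coordinate; the bounded support of [f] removes the boundary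
    terms. *)
Lemma Rintegral_laplacian f g : Cn 2 f -> Cn 2 g -> bounded_support f ->
  \int[mu]_x (f x * laplacian g x) = \int[mu]_x (laplacian f x * g x).
Proof.
move=> Cf Cg sf; rewrite /laplacian.
under eq_Rintegral do rewrite mulr_sumr.
under [RHS]eq_Rintegral do rewrite mulr_suml.
have [|-> _] := @Rintegral_sum _ (index_enum 'I_d) (fun i x => f x * partial i (partial i g) x).
  move=> i; apply: continuous_bounded_support_integrable; last exact: bounded_supportMl.
  apply: continuous_mul; [exact: (Cn_continuous Cf) |].
  exact: (Cn_continuous (Cn_partial i (Cn_partial i Cg))).
have [|-> _] := @Rintegral_sum _ (index_enum 'I_d) (fun i x => partial i (partial i f) x * g x).
  move=> i; apply: continuous_bounded_support_integrable; last by apply: bounded_supportMl; do 2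
      apply: bounded_support_derive.
  apply: continuous_mul; last exact: (Cn_continuous Cg).
  exact: (Cn_continuous (Cn_partial i (Cn_partial i Cf))).
apply: eq_bigr => i _.
rewrite (Rintegral_by_parts i (CnS Cf) (Cn_partial i Cg) sf).
rewrite (Rintegral_by_parts i (Cn_partial i Cf) (CnS Cg) (bounded_support_derive _ sf)).
by rewrite opprK.
Qed.

End smooth.

(** * From exponential decay to a resolvent estimate *)

Section semigroup_estimate.
Local Open Scope complex_scope.
Variables (R : realType) (X : lmodType R[i]).
Variables (H : set X) (eqv : X -> X -> Prop) (nrm : X -> R).
Local Notation Re := complex.Re.
Local Notation Im := complex.Im.

Definition unit_disc : set R[i] := [set a | Re a ^+ 2 + Im a ^+ 2 <= 1].

Lemma unit_discM a b : unit_disc a -> unit_disc b -> unit_disc (a * b).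
Proof.
rewrite /unit_disc /=; case: a => a1 a2; case: b => b1 b2 /= ha hb.
have -> : (a1 * b1 - a2 * b2) ^+ 2 + (a1 * b2 + a2 * b1) ^+ 2 =
  (a1 ^+ 2 + a2 ^+ 2) * (b1 ^+ 2 + b2 ^+ 2) by ring.
by rewrite mulr_ile1 // addr_ge0 // sqr_ge0.
Qed.

Lemma unit_discX a n : unit_disc a -> unit_disc (a ^+ n).
Proof.
move=> ha; elim: n => [|n IH]; first by rewrite expr0 /unit_disc /= expr1n expr0n /= addr0.
by rewrite exprS; exact: unit_discM.
Qed.

(** These hypotheses describe a seminorm on [H]. Homogeneity is split into contraction by scalars of
    the unit disc and exact scaling by nonnegative reals, the two forms that the estimates use. *)
Hypothesis H_lin : forall a U W, H U -> H W -> H (a *: U + W).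
Hypothesis nrm_ge0 : forall U, 0 <= nrm U.
Hypothesis nrmD : forall U W, H U -> H W -> nrm (U + W) <= nrm U + nrm W.
Hypothesis nrmZ_disc : forall a U, unit_disc a -> H U -> nrm (a *: U) <= nrm U.
Hypothesis nrmZ_real : forall (c : R) U, 0 <= c -> H U -> nrm (c%:C *: U) = c * nrm U.
Hypothesis nrm_eqv : forall U W, H U -> H W -> eqv U W -> nrm (U - W) = 0.

Let H_Z a U : H U -> H (a *: U).
Proof.
by move=> HU; have := H_lin (a - 1) HU HU; rewrite scalerBl scale1r subrK.
Qed.

Let H_D U W : H U -> H W -> H (U + W).
Proof. by move=> HU HW; have := H_lin 1 HU HW; rewrite scale1r. Qed.

Let H_N U : H U -> H (- U).
Proof. by move=> HU; rewrite -scaleN1r; exact: H_Z. Qed.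

Let H_B U W : H U -> H W -> H (U - W).
Proof. by move=> HU HW; apply: H_D => //; exact: H_N. Qed.

Let nrm_near U W : H U -> H W -> nrm (U - W) = 0 -> nrm U <= nrm W.
Proof.
move=> HU HW UW; rewrite -{1}(subrK W U).
by apply: (le_trans (nrmD (H_B HU HW) HW)); rewrite UW add0r.
Qed.

(** Linearity is applied to the scalar [a - 1] and twice the same vector, which needs no separate
    statement about the value at 0. *)
Let lin_scale A a U : bounded_linear H eqv nrm A -> H U -> nrm (A (a *: U) - a *: A U) = 0.
Proof.
move=> [HA linA _] HU; have := linA (a - 1) U U HU HU.
rewrite scalerBl scale1r subrK -[X in eqv _ (_ + X)](scale1r (A U)) -scalerDl subrK.
move/nrm_eqv; apply; first by apply: HA; exact: H_Z.
by apply: H_Z; exact: HA.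
Qed.

Lemma opnorm_le A M U : bounded_linear H eqv nrm A -> 0 <= M -> (opnorm H nrm A <= M%:E)%E -> H U ->
  nrm (A U) <= M * nrm U.
Proof.
move=> bA M0 AM HU; have [HA _ _] := bA.
(* [nrm U] may be 0, so [U] is normalised by an arbitrary [r] above it, which then decreases to
   [nrm U]. *)
have key r : nrm U < r -> nrm (A U) <= M * r.
  move=> Ur; have r0 : 0 < r by apply: le_lt_trans Ur.
  have ri0 : 0 <= r^-1 by rewrite invr_ge0 ltW.
  have U'1 : nrm ((r^-1)%:C *: U) <= 1.
    by rewrite nrmZ_real // mulrC ler_pdivrMr // mul1r ltW.
  have h1 : nrm (A ((r^-1)%:C *: U)) <= M.
    rewrite -lee_fin; apply: le_trans AM; apply: ereal_sup_ubound.
    by exists ((r^-1)%:C *: U) => //; split => //; exact: H_Z.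
  have h2 : nrm ((r^-1)%:C *: A U) <= nrm (A ((r^-1)%:C *: U)).
    have := lin_scale (- (r^-1)%:C) bA HU; rewrite !scaleNr opprK => h.
    apply: nrm_near; [by apply: H_Z; exact: HA|by apply: HA; exact: H_Z|].
    have e := lin_scale (r^-1)%:C bA HU.
    apply/eqP; rewrite eq_le nrm_ge0 andbT -[X in _ <= X]e -[X in nrm X <= _]opprB -[X in nrm X
        <= _]scaleN1r.
    apply: nrmZ_disc; first by rewrite /unit_disc /= sqrrN expr1n oppr0 expr0n /= addr0.
    by apply: H_B; [apply: HA; exact: H_Z|by apply: H_Z; exact: HA].
  move: h2; rewrite (nrmZ_real ri0 (HA _ HU)) => h2.
  by rewrite -ler_pdivrMr // mulrC; apply: le_trans h2 h1.
apply/ler_addgt0Pr => e e0.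
have M1 : 0 < M + 1 by rewrite ltr_wpDl.
have := key (nrm U + e / (M + 1)); rewrite ltrDl divr_gt0 // => /(_ isT) /le_trans; apply.
rewrite mulrDr lerD2l mulrA ler_pdivrMr // mulrC ler_wpM2l //; [exact: ltW | lra].
Qed.

Variables (T : R -> X -> X) (C tau : R).
Hypothesis semT : C0_semigroup H eqv nrm T.
Hypothesis C0 : 0 < C.
Hypothesis tau0 : 0 < tau.
Hypothesis decay : forall t, 0 <= t -> (opnorm H nrm (T t) <= (C * expR (- t / tau))%:E)%E.

Let TH t U : 0 <= t -> H U -> H (T t U).
Proof. by move=> t0; have [+ _ _ _] := semT => /(_ _ t0)[+ _ _]; exact. Qed.

Let T_decay t U : 0 <= t -> H U -> nrm (T t U) <= C * expR (- t / tau) * nrm U.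
Proof.
move=> t0 HU; apply: opnorm_le => //; last exact: decay.
  by have [+ _ _ _] := semT; exact.
by rewrite mulr_ge0 ?expR_ge0 // ltW.
Qed.

Let T_le t U : 0 <= t -> H U -> nrm (T t U) <= C * nrm U.
Proof.
move=> t0 HU; apply: le_trans (T_decay t0 HU) _.
rewrite ler_wpM2r // -[leRHS]mulr1 ler_wpM2l ?(ltW C0)// -expR0 ler_expR.
by rewrite mulNr oppr_le0 divr_ge0 // ltW.
Qed.

(* Telescoping [z^n T(n h) U - U], with [z] in the unit disc. *)
Let step z h n U : 0 <= h -> unit_disc z -> H U ->
  nrm (z ^+ n *: T (n%:R * h) U - U) <= n%:R * (C * nrm (z *: T h U - U)).
Proof.
move=> h0 dz HU; have [bT T0 TD _] := semT.
have nh m : 0 <= m%:R * h by rewrite mulr_ge0.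
have HTh : H (T h U) by exact: TH.
have HD : H (z *: T h U - U) by apply: H_B => //; exact: H_Z.
elim: n => [|n IH].
  rewrite !mul0r expr0 scale1r nrm_eqv //; first exact: TH.
  exact: T0.
pose V := T h U; pose S := T (n%:R * h); pose D := z *: V - U.
have HS W : H W -> H (S W) by exact: TH.
have e1 : nrm (T (n.+1%:R * h) U - S V) = 0.
  apply: nrm_eqv; [exact: TH|exact: HS|].
  by rewrite -natr1 mulrDl mul1r; exact: TD.
have e2 : nrm (S D - (z *: S V - S U)) = 0.
  have [_ linS _] := bT _ (nh n).
  have a1 := linS (-1) U (z *: V) HU (H_Z _ HTh).
  have E1 : nrm (S D - (-1 *: S U + S (z *: V))) = 0.
    have -> : D = -1 *: U + z *: V by rewrite scaleN1r addrC.
    apply: nrm_eqv => //.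
      by apply: HS; apply: H_lin => //; exact: H_Z.
    by apply: H_lin; [exact: HS|by apply: HS; exact: H_Z].
  have E2 := lin_scale z (bT _ (nh n)) HTh.
  apply/eqP; rewrite eq_le nrm_ge0 andbT.
  have -> : S D - (z *: S V - S U) = (S D - (-1 *: S U + S (z *: V))) + (S (z *: V) - z *: S V).
    by rewrite scaleN1r opprB opprD opprK !addrA subrK.
  apply: le_trans (nrmD _ _) _; last by rewrite E1 E2 addr0.
    apply: H_B; [exact: HS|apply: H_lin; [exact: HS|by apply: HS; exact: H_Z]].
  by apply: H_B; [by apply: HS; exact: H_Z|by apply: H_Z; exact: HS].
(* The semigroup law and linearity hold only up to [eqv]. The brackets [a - b] and [c - (b - e)]
   carry these two errors, of norm 0; [c] is the new increment and [e - u] is left to the induction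
   hypothesis. *)
have tele (M : zmodType) (a b c e u : M) : a - u = (a - b) + (c - (c - (b - e))) + (e - u).
  by rewrite subKr !addrA !subrK.
have dn m : unit_disc (z ^+ m) by exact: unit_discX.
rewrite (tele _ _ (z ^+ n.+1 *: S V) (z ^+ n *: S D) (z ^+ n *: S U)) -scalerBr exprSr -!scalerA
    -!scalerBr.
have HSD : H (S D) by exact: HS.
have HA1 : H (T (n.+1%:R * h) U - S V) by apply: H_B; [exact: TH|exact: HS].
have HA2 : H (S D - (z *: S V - S U)).
  by apply: H_B => //; apply: H_B; [by apply: H_Z; exact: HS|exact: HS].
have HSU : H (S U) by exact: HS.
rewrite -[X in _ <= X * _]natr1 [leRHS]mulrDl mul1r [X in nrm X <= _]addrC.
apply: le_trans (nrmD _ _) _.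
- by apply: H_B => //; exact: H_Z.
- by apply: H_D; [do 2 apply: H_Z|apply: H_Z; apply: H_B].
apply: lerD; first exact: IH.
apply: le_trans (nrmD _ _) _; [by do 2 apply: H_Z|by apply: H_Z; apply: H_B|].
rewrite -[leRHS]add0r; apply: lerD.
  by apply: le_trans (nrmZ_disc _ _) _; [exact: dn|exact: H_Z|rewrite -e1; exact: nrmZ_disc].
apply: le_trans (nrmZ_disc _ _) _; [exact: dn|exact: H_B|].
apply: le_trans (nrmD _ _) _; [by []|exact: H_N|].
rewrite -[leRHS]addr0; apply: lerD; first exact: T_le.
rewrite -scaleN1r -e2; apply: nrmZ_disc => //.
by rewrite /unit_disc /= sqrrN expr1n oppr0 expr0n /= addr0.
Qed.

(** Discrete form of the identity exp(- i om t) T(t) W - W = int_0^t exp(- i om s) T(s) (Z - i om W)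
    ds: the first term decays, and the integral is at most t C |Z - i om W|. *)
Lemma semigroup_resolvent_estimate W Z (om t : R) : 0 < t -> generator H nrm T W Z ->
  nrm W <= C * expR (- t / tau) * nrm W + t * (C * nrm (Z - (0 +i* om) *: W)).
Proof.
move=> t0 [HW HZ /cvgrPdist_lt gen].
set Y := Z - _ *: W; have HY : H Y by apply: H_B => //; exact: H_Z.
apply/ler_addgt0Pr => e e0.
(* With this tolerance each of the steps of length [h] costs at most C h e / (t C), which adds up to
   [e] over the time [t]. *)
have e'0 : 0 < e / (t * C) by rewrite divr_gt0 // mulr_gt0.
have [dl /= dl0 {}gen] := gen _ e'0.
have [N Nt] : exists N : nat, t / N.+1%:R < dl.
  exists (Num.truncn (t / dl)); rewrite ltr_pdivrMr ?ltr0n // mulrC -ltr_pdivrMr //.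
  exact: truncnS_gt.
pose h := t / N.+1%:R.
have h0 : 0 < h by rewrite divr_gt0 // ltr0n.
have Nh : N.+1%:R * h = t by rewrite /h mulrC divfK // pnatr_eq0.
have := gen h; rewrite /= sub0r normrN (gtr0_norm h0) => /(_ Nt h0).
rewrite sub0r normrN ger0_norm // => gh.
(* [z = (1 + i om h)^-1] replaces [exp(- i om h)]: it lies in the unit disc, and
   [z T(h) W - W = z h ((T(h) W - W) / h - i om W)] holds exactly. *)
pose k := om * h; pose q := (1 + k ^+ 2)^-1.
pose z : R[i] := q +i* (- k * q).
have q1 : q * (1 + k ^+ 2) = 1 by rewrite mulVf // gt_eqF // ltr_wpDr // sqr_ge0.
have q0 : 0 <= q <= 1.
  have k1 : 0 < 1 + k ^+ 2 by rewrite ltr_wpDr // sqr_ge0.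
  by rewrite invr_ge0 (ltW k1) /= invf_le1 // lerDl sqr_ge0.
have dz : unit_disc z.
  rewrite /unit_disc /=.
  have -> : q ^+ 2 + (- k * q) ^+ 2 = q * (q * (1 + k ^+ 2)) by ring.
  by rewrite q1 mulr1; case/andP: q0.
have zk : z * (1 +i* k) = 1.
  apply/eqP; rewrite eq_complex /=; apply/andP; split; apply/eqP; last by ring.
  by rewrite -[RHS]q1; ring.
have bT : bounded_linear H eqv nrm (T h) by have [+ _ _ _] := semT; apply; exact: ltW.
have HT : H (T h W) by apply: TH => //; exact: ltW.
pose G := (h^-1)%:C *: (T h W - W) - Z.
have HG : H G by apply: H_B => //; apply: H_Z; exact: H_B.
have DE : z *: T h W - W = z *: (h%:C *: (G + Y)).
  rewrite -{2}[W]scale1r -zk -scalerA -scalerBr; congr (_ *: _).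
  rewrite /G /Y addrA subrK scalerBr !scalerA -rmorphM /= mulfV ?gt_eqF // scale1r.
  rewrite -addrA -opprD -[X in X + _ *: W]scale1r -scalerDl; congr (_ - _ *: _).
  by apply/eqP; rewrite eq_complex /=; apply/andP; split; apply/eqP; rewrite /k; ring.
have Dle : nrm (z *: T h W - W) <= h * (nrm G + nrm Y).
  rewrite DE; apply: le_trans (nrmZ_disc _ _) _ => //; first by apply: H_Z; exact: H_D.
  by rewrite nrmZ_real ?(ltW h0)//; [rewrite ler_wpM2l ?(ltW h0)//; exact: nrmD|exact: H_D].
have st := step N.+1 (ltW h0) dz HW.
rewrite Nh in st.
have HF : H (z ^+ N.+1 *: T t W) by apply: H_Z; apply: TH => //; exact: ltW.
have F_le : nrm (z ^+ N.+1 *: T t W) <= C * expR (- t / tau) * nrm W.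
  apply: le_trans (nrmZ_disc _ _) _; [exact: unit_discX|by apply: TH => //; exact: ltW|].
  by apply: T_decay => //; exact: ltW.
have nN U : H U -> nrm (- U) <= nrm U.
  move=> HU; rewrite -scaleN1r; apply: nrmZ_disc => //.
  by rewrite /unit_disc /= sqrrN expr1n oppr0 expr0n /= addr0.
rewrite -addrA; have -> : W = z ^+ N.+1 *: T t W - (z ^+ N.+1 *: T t W - W) by rewrite subKr.
apply: le_trans (nrmD HF _) _; first by apply: H_N; exact: H_B.
rewrite subKr; apply: lerD => //; apply: le_trans (nN _ _) _; first exact: H_B.
apply: le_trans st _.
have -> : t * (C * nrm Y) + e = N.+1%:R * (C * (h * (e / (t * C) + nrm Y))).
  rewrite -[RHS](_ : (N.+1%:R * h) * (C * (e / (t * C) + nrm Y)) = _); last by ring.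
  by rewrite Nh; field; rewrite !gt_eqF.
rewrite ler_wpM2l // ler_wpM2l ?(ltW C0) //; apply: le_trans Dle _.
by rewrite ler_wpM2l ?(ltW h0) // lerD2r ltW.
Qed.

End semigroup_estimate.

(** * Real inner products on L^2 and the Cauchy-Schwarz inequality *)

Section L2_theory.
Local Open Scope complex_scope.
Variables (R : realType) (d : nat).
Local Notation E := 'rV[R]_d.
Local Notation mu := (lebesgue_rV R d).
Local Notation Re := complex.Re.
Local Notation Im := complex.Im.
Local Notation state := ((E -> R[i]) * (E -> R[i]))%type.
Implicit Types (u v w f g : E -> R[i]) (p q : state).

Lemma Lfun2P (f : E -> R) : f \in Lfun mu 2%:E <->
  measurable_fun setT f /\ mu.-integrable setT (EFin \o (fun x => f x ^+ 2)).
Proof.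
split=> [f2|[mf sf]].
  split; last exact: Lfun2_integrable_sqr.
  by have /sub_Lfun_mfun := f2; rewrite inE.
rewrite inE; apply/andP; split; rewrite inE //=.
rewrite /finite_norm unlock /Lnorm poweR_lty //.
have /integrableP[_] := sf; apply: le_lt_trans; apply: ge0_le_integral => //.
- by move=> x _; rewrite lee_fin powR_ge0.
- apply/measurable_EFinP; apply: (measurableT_comp (measurable_powR _)) => //.
  exact: measurableT_comp.
- by apply: measurableT_comp => //; apply/measurable_EFinP; exact: measurable_funX.
- by move=> x _; rewrite /= lee_fin powR_mulrn // normrX.
Qed.

Lemma Lfun2D (f g : E -> R) : f \in Lfun mu 2%:E -> g \in Lfun mu 2%:E ->
  (fun x => f x + g x) \in Lfun mu 2%:E.
Proof. by move=> f2 g2; have [_ D] := @Lfun_addr_closed _ _ _ mu _ (lee1n 2); exact: D. Qed.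

Lemma Lfun2Z (a : R) (f : E -> R) : f \in Lfun mu 2%:E -> (fun x => a * f x) \in Lfun mu 2%:E.
Proof.
have r12 : 1 <= 2 :> R by rewrite ler1n.
move=> f2; have := Lfun_scale a r12 f2.
by rewrite (_ : _ \o* _ = (fun x => a * f x)) //; apply/funext => x /=; rewrite mulrC.
Qed.

Lemma Lfun2_mul_integrable (f g : E -> R) : f \in Lfun mu 2%:E -> g \in Lfun mu 2%:E ->
  mu.-integrable setT (EFin \o (fun x => f x * g x)).
Proof. by move=> f2 g2; apply/Lfun1_integrable; exact: Lfun2_mul_Lfun1. Qed.

Lemma L2_lin (a : R[i]) u v : L2 u -> L2 v -> L2 (fun x => a * u x + v x).
Proof.
case: a => a b [u1 u2] [v1 v2]; split.
  rewrite (_ : (fun x => _) = (fun x => a * Re (u x) + (- b) * Im (u x) + Re (v x))).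
    exact: Lfun2D (Lfun2D (Lfun2Z a u1) (Lfun2Z (- b) u2)) v1.
  by apply/funext => x; case: (u x) => ? ?; case: (v x) => ? ? /=; ring.
rewrite (_ : (fun x => _) = (fun x => a * Im (u x) + b * Re (u x) + Im (v x))).
  exact: Lfun2D (Lfun2D (Lfun2Z a u2) (Lfun2Z b u1)) v2.
by apply/funext => x; case: (u x) => ? ?; case: (v x) => ? ? /=; ring.
Qed.

Lemma L2_0 : L2 (fun _ : E => 0 : R[i]).
Proof.
have h : (fun _ : E => 0 : R) \in Lfun mu 2%:E.
  have [+ _] := @Lfun_addr_closed _ _ _ mu _ (lee1n 2); exact.
by split.
Qed.

Lemma L2Z (a : R[i]) u : L2 u -> L2 (fun x => a * u x).
Proof.
move=> hu; rewrite (_ : (fun x => _) = (fun x => a * u x + 0)); last by apply/funext => x;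
    rewrite addr0.
exact: L2_lin hu L2_0.
Qed.

(** The real part of [L2inner]. The imaginary part is recovered by replacing [v] with ['i * v], so
    only real integrals have to be estimated. *)
Definition re_inner u v := \int[mu]_x (Re (u x) * Re (v x) + Im (u x) * Im (v x)).

Lemma Re_mulconj (a b : R[i]) : Re (a * b^*) = Re a * Re b + Im a * Im b.
Proof. by case: a => a1 a2; case: b => b1 b2 /=; ring. Qed.

Lemma Im_mulconj (a b : R[i]) : Im (a * b^*) = Im a * Re b - Re a * Im b.
Proof. by case: a => a1 a2; case: b => b1 b2 /=; ring. Qed.

Lemma Re_L2inner u v : Re (L2inner u v) = re_inner u v.
Proof. by rewrite /L2inner /cintegral /=; under eq_Rintegral do rewrite Re_mulconj. Qed.

Lemma Im_L2inner u v : Im (L2inner u v) = re_inner u (fun x => 'i * v x).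
Proof.
rewrite /L2inner /cintegral /=; apply: eq_Rintegral => x _; rewrite Im_mulconj.
by case: (u x) => ? ?; case: (v x) => ? ? /=; ring.
Qed.

Lemma L2innerE u v : L2inner u v = re_inner u v +i* re_inner u (fun x => 'i * v x).
Proof. by rewrite -Im_L2inner -Re_L2inner; case: (L2inner u v). Qed.

Lemma re_innerC u v : re_inner u v = re_inner v u.
Proof. by apply: eq_Rintegral => x _; rewrite mulrC (mulrC (Im _)). Qed.

Lemma re_inner_integrable u v : L2 u -> L2 v ->
  mu.-integrable setT (EFin \o (fun x => Re (u x) * Re (v x) + Im (u x) * Im (v x))).
Proof.
move=> [u1 u2] [v1 v2].
exact: (integrableD measurableT (Lfun2_mul_integrable u1 v1) (Lfun2_mul_integrable u2 v2)).
Qed.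

Lemma re_innerD u v w : L2 u -> L2 v -> L2 w -> re_inner u (fun x => v x + w x) = re_inner u v +
    re_inner u w.
Proof.
move=> hu hv hw; rewrite /re_inner -RintegralD //; try exact: re_inner_integrable.
by apply: eq_Rintegral => x _; case: (v x) => ? ?; case: (w x) => ? ? /=; ring.
Qed.

Lemma re_innerZ (c : R) u v : L2 u -> L2 v -> re_inner u (fun x => c%:C * v x) = c * re_inner u v.
Proof.
move=> hu hv; rewrite /re_inner -RintegralZl //; last exact: re_inner_integrable.
by apply: eq_Rintegral => x _; case: (v x) => ? ? /=; ring.
Qed.

Lemma re_innerZZ (a : R[i]) u : L2 u ->
  re_inner (fun x => a * u x) (fun x => a * u x) = (Re a ^+ 2 + Im a ^+ 2) * re_inner u u.
Proof.
move=> hu; rewrite /re_inner -RintegralZl //; last exact: re_inner_integrable.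
by apply: eq_Rintegral => x _; case: a => ? ?; case: (u x) => ? ? /=; ring.
Qed.

Lemma re_inner_ge0 u : 0 <= re_inner u u.
Proof. by apply: Rintegral_ge0 => x _; rewrite -!expr2 addr_ge0 // sqr_ge0. Qed.

Lemma re_inner_lin (a : R[i]) u v w : L2 u -> L2 v -> L2 w ->
  re_inner u (fun x => a * v x + w x) = Re a * re_inner u v + Im a * re_inner u (fun x => 'i * v
      x) + re_inner u w.
Proof.
case: a => a b hu hv hw.
have hi : L2 (fun x => 'i * v x) by exact: L2Z.
rewrite -(re_innerZ a hu hv) -(re_innerZ b hu hi) -!re_innerD //; try exact: L2Z.
  by apply: eq_Rintegral => x _; case: (v x) => ? ?; case: (w x) => ? ? /=; ring.
by have := L2_lin a%:C hv (L2Z b%:C hi).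
Qed.

Lemma L2inner_lin (a : R[i]) u v w : L2 u -> L2 v -> L2 w ->
  L2inner u (fun x => a * v x + w x) = a^* * L2inner u v + L2inner u w.
Proof.
move=> hu hv hw; rewrite !L2innerE re_inner_lin //.
have -> : (fun x => 'i * (a * v x + w x)) = (fun x => a * ('i * v x) + 'i * w x).
  by apply/funext => x; ring.
rewrite re_inner_lin //; try exact: L2Z.
have -> : re_inner u (fun x => 'i * ('i * v x)) = - re_inner u v.
  rewrite -mulN1r -re_innerZ //; congr re_inner; apply/funext => x.
  by case: (v x) => ? ?; apply/eqP; rewrite eq_complex /=; apply/andP; split; apply/eqP; ring.
case: a => a b; move: (re_inner u v) (re_inner u w) (re_inner u (fun x => 'i * v x)) (re_inner u
    (fun x => 'i * w x)) => p q p' q'.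
by apply/eqP; rewrite eq_complex /=; apply/andP; split; apply/eqP; ring.
Qed.

Lemma ae_eq_re_inner u u' v : L2 u -> L2 u' -> L2 v -> u = u' %[ae mu] -> re_inner u v = re_inner
    u' v.
Proof.
move=> hu hu' hv uu'; congr fine; apply: ae_eq_integral => //.
- by have /integrableP[] := re_inner_integrable hu hv.
- by have /integrableP[] := re_inner_integrable hu' hv.
- by apply: filterS uu' => x /= + _ => /(_ I) ->.
Qed.

Lemma quadratic_cs (A B C : R) : 0 <= A -> 0 <= C ->
  (forall a b, 0 <= a ^+ 2 * A - 2 * (a * b * B) + b ^+ 2 * C) -> B <= Num.sqrt A * Num.sqrt C.
Proof.
move=> A0 C0 h.
(* The choices (C, B) and (B, A) give C (A C - B^2) >= 0 and A (A C - B^2) >= 0; the choices (1, 1)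
   and (1, -1) settle the degenerate case A = C = 0. *)
have hC := h C B; have hA := h B A; have h1 := h 1 1; have h2 := h 1 (-1).
suff : B ^+ 2 <= A * C.
  rewrite -sqrtrM // => BAC; apply: le_trans (ler_norm B) _.
  by rewrite -sqrtr_sqr ler_wsqrtr.
have [A_0|A_0] := eqVneq A 0; last first.
  have Ap : 0 < A by rewrite lt_neqAle eq_sym A_0.
  have : 0 <= A * (A * C - B ^+ 2) by apply: le_trans hA _; rewrite le_eqVlt; apply/orP; left;
      apply/eqP; ring.
  by rewrite pmulr_rge0 // subr_ge0.
have [C_0|C_0] := eqVneq C 0; last first.
  have Cp : 0 < C by rewrite lt_neqAle eq_sym C_0.
  have : 0 <= C * (A * C - B ^+ 2) by apply: le_trans hC _; rewrite le_eqVlt; apply/orP; left;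
      apply/eqP; ring.
  by rewrite pmulr_rge0 // subr_ge0.
have -> : B = 0 by rewrite A_0 C_0 in h1 h2; lra.
by rewrite expr0n mulr_ge0.
Qed.

(** A pair stands for (P^(1/2) u, v), in terms of which the energy norm is a plain L^2 norm. *)
Definition L2_pair p := L2 p.1 /\ L2 p.2.
Definition pair_inner p q := re_inner p.1 q.1 + re_inner p.2 q.2.
Definition pair_norm p := Num.sqrt (pair_inner p p).

Lemma pair_inner_ge0 p : 0 <= pair_inner p p.
Proof. by rewrite addr_ge0 // re_inner_ge0. Qed.

Lemma re_inner_comb (a b : R) u v : L2 u -> L2 v ->
  re_inner (fun x => a%:C * u x + b%:C * v x) (fun x => a%:C * u x + b%:C * v x) =
  a ^+ 2 * re_inner u u + 2 * (a * b * re_inner u v) + b ^+ 2 * re_inner v v.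
Proof.
move=> hu hv.
have hs : L2 (fun x => a%:C * u x + b%:C * v x) by apply: L2_lin => //; exact: L2Z.
rewrite re_innerD //; try exact: L2Z.
rewrite !re_innerZ // !(re_innerC (fun x => _ + _)) !re_innerD //; try exact: L2Z.
rewrite !re_innerZ // (re_innerC v u); ring.
Qed.

Lemma pair_inner_comb (a b : R) p q : L2_pair p -> L2_pair q ->
  pair_inner (a%:C *: p + b%:C *: q) (a%:C *: p + b%:C *: q) =
  a ^+ 2 * pair_inner p p + 2 * (a * b * pair_inner p q) + b ^+ 2 * pair_inner q q.
Proof.
move=> [p1 p2] [q1 q2]; rewrite /pair_inner.
rewrite (_ : (a%:C *: p + b%:C *: q).1 = fun x => a%:C * p.1 x + b%:C * q.1 x) //.
rewrite (_ : (a%:C *: p + b%:C *: q).2 = fun x => a%:C * p.2 x + b%:C * q.2 x) //.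
by rewrite !re_inner_comb //; ring.
Qed.

Lemma pair_inner_cs p q : L2_pair p -> L2_pair q -> pair_inner p q <= pair_norm p * pair_norm q.
Proof.
move=> hp hq; apply: quadratic_cs; try exact: pair_inner_ge0.
move=> a b; have := pair_inner_ge0 (a%:C *: p + (- b)%:C *: q).
by rewrite pair_inner_comb // sqrrN mulrN mulNr mulrN.
Qed.

Lemma pair_normD p q : L2_pair p -> L2_pair q -> pair_norm (p + q) <= pair_norm p + pair_norm q.
Proof.
move=> hp hq.
have -> : p + q = (1:R)%:C *: p + (1:R)%:C *: q by rewrite !scale1r.
rewrite /pair_norm pair_inner_comb // !expr1n !mul1r.
rewrite -[leRHS]ger0_norm ?addr_ge0 ?sqrtr_ge0// -sqrtr_sqr ler_wsqrtr //.
rewrite sqrrD !sqr_sqrtr ?pair_inner_ge0 // lerD2r lerD2l -[leRHS]mulr_natl ler_wpM2l //.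
exact: pair_inner_cs.
Qed.

Lemma pair_innerZ (a : R[i]) p : L2_pair p -> pair_inner (a *: p) (a *: p) = (Re a ^+ 2 + Im a ^+
    2) * pair_inner p p.
Proof. by move=> [p1 p2]; rewrite /pair_inner mulrDr; congr (_ + _); exact: re_innerZZ. Qed.

Lemma pair_normZ_disc (a : R[i]) p : unit_disc a -> L2_pair p -> pair_norm (a *: p) <= pair_norm p.
Proof.
move=> ha hp; rewrite /pair_norm pair_innerZ // ler_wsqrtr //.
by rewrite -[leRHS]mul1r ler_wpM2r // pair_inner_ge0.
Qed.

Lemma pair_normZ_real (c : R) p : 0 <= c -> L2_pair p -> pair_norm (c%:C *: p) = c * pair_norm p.
Proof.
move=> c0 hp; rewrite /pair_norm pair_innerZ //= expr0n addr0 sqrtrM ?sqr_ge0 //.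
by rewrite sqrtr_sqr ger0_norm.
Qed.

End L2_theory.

(** * Consequences of self-adjointness, and the energy norm *)

Section damped_wave_resolvent.
Local Open Scope complex_scope.
Variables (R : realType) (d : nat).
Local Notation E := 'rV[R]_d.
Local Notation mu := (lebesgue_rV R d).
Local Notation Re := complex.Re.
Local Notation Im := complex.Im.
Local Notation state := ((E -> R[i]) * (E -> R[i]))%type.

Lemma Linf_ae_bounded (f : E -> R) : f \in Lfun mu +oo%E ->
  measurable_fun setT f /\ exists2 M : R, 0 <= M & {ae mu, forall x, `|f x| <= M}.
Proof.
move=> /[dup] /sub_Lfun_mfun; rewrite inE /= => mf /sub_Lfun_finLfun; rewrite inE /= => h; split
    => //.
move: h; rewrite /finite_norm unlock /Lnorm.
case: ifPn => [_ fy|].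
  exists `|fine (ess_sup mu (abse \o (EFin \o f)))|; first by [].
  apply: filterS (ess_sup_ge mu (abse \o (EFin \o f))) => x /= h.
  rewrite -lee_fin; apply: le_trans h _.
  move: fy; case: (ess_sup _ _) => [r _|//|_]; last by rewrite leNye.
  by rewrite lee_fin /= ler_norm.
(* This branch is that of a whole space of measure zero, where any bound holds almost everywhere. *)
rewrite -leNgt => mu0 _; exists 0 => //; exists setT; split => //.
by apply/eqP; rewrite eq_le mu0 measure_ge0.
Qed.

Lemma Lfun2_dominated (h g : E -> R) (M : R) : measurable_fun setT h -> g \in Lfun mu 2%:E ->
  {ae mu, forall x, `|h x| <= M * `|g x|} -> h \in Lfun mu 2%:E.
Proof.
move=> mh /Lfun2P[mg ig] hg; apply/Lfun2P; split => //.
apply/integrableP; split; first by apply/measurable_EFinP; exact: measurable_funX.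
have iMg : mu.-integrable setT (fun x => (M ^+ 2)%:E * (g x ^+ 2)%:E)%E by exact: integrableZl.
have /integrableP[_] := iMg; apply: le_lt_trans; apply: ae_ge0_le_integral => //.
- by apply: measurableT_comp => //; apply/measurable_EFinP; exact: measurable_funX.
- by apply: measurableT_comp => //; case/integrableP : iMg.
- apply: filterS hg => x hx _ /=; rewrite lee_fin -exprMn !normrX normrM.
  rewrite lerXn2r ?nnegrE ?mulr_ge0 //; apply: le_trans hx _.
  by rewrite ler_wpM2r // ler_norm.
Qed.

Variable S : operator R d.
Hypothesis saS : self_adjoint S.

Lemma sa_L2 u f : S u f -> L2 u /\ L2 f.
Proof. by move=> /(saS.2 _ _).1 [? ? _]. Qed.

(** Linearity is not part of the encoding by graphs. It holds because [S] equals its adjoint, whose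
    defining condition is linear in the pair. *)
Lemma sa_lin (a : R[i]) u f v g : S u f -> S v g -> S (fun x => a * u x + v x) (fun x => a * f x
    + g x).
Proof.
move=> Suf Svg; apply/(saS.2 _ _).
have [_ _ hu] := (saS.2 _ _).1 Suf; have [_ _ hv] := (saS.2 _ _).1 Svg.
have [Lu Lf] := sa_L2 Suf; have [Lv Lg] := sa_L2 Svg.
split; [exact: L2_lin|exact: L2_lin|] => w k Swk.
have [Lw Lk] := sa_L2 Swk.
by rewrite !L2inner_lin // (hu _ _ Swk) (hv _ _ Swk).
Qed.

Lemma sa_0 u f : S u f -> S (fun=> 0) (fun=> 0).
Proof.
move=> Suf; have := sa_lin (-1) Suf Suf.
have z w : (fun x => -1 * w x + w x) = (fun=> 0) :> (E -> R[i]).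
  by apply/funext => x; rewrite mulN1r addNr.
by rewrite !z.
Qed.

Lemma sa_Z (a : R[i]) u f : S u f -> S (fun x => a * u x) (fun x => a * f x).
Proof.
move=> Suf; have := sa_lin a Suf (sa_0 Suf).
have z w : (fun x => a * w x + 0) = (fun x => a * w x) :> (E -> R[i]).
  by apply/funext => x; rewrite addr0.
by rewrite !z.
Qed.

(** A value of [S] at a null function is orthogonal to the domain of [S], which is dense. This makes
    [S] well defined modulo null functions. *)
Lemma sa_null u e : S u e -> u = (fun=> 0) %[ae mu] -> re_inner e e = 0.
Proof.
move=> Sue u0; have [Lu Le] := sa_L2 Sue; have [_ _ hu] := (saS.2 _ _).1 Sue.
have orth w k : S w k -> re_inner w e = 0.
  move=> Swk; have [Lw Lk] := sa_L2 Swk.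
  rewrite -Re_L2inner -(hu _ _ Swk) Re_L2inner re_innerC (ae_eq_re_inner Lu (@L2_0 _ _) Lk u0).
  by rewrite /re_inner; under eq_Rintegral do rewrite /= !mul0r addr0; rewrite Rintegral_cst //
      mul0r.
apply/eqP; rewrite eq_le re_inner_ge0 andbT; apply/ler_addgt0Pr => eps eps0; rewrite add0r.
have [[_ dense] _] := saS.
(* Since [e] is orthogonal to [w], |e|^2 <= |e|^2 + |w|^2 = |e - w|^2 < eps. *)
have [w [k Swk] we] := dense e Le (Num.sqrt eps) ltac:(by rewrite sqrtr_gt0).
have [Lw Lk] := sa_L2 Swk.
have := re_inner_comb 1 (-1) Le Lw.
rewrite (_ : (fun x => _) = e - w); last first.
  apply/funext => x; rewrite !fctE; case: (e x) => ? ?; case: (w x) => ? ?.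
  by apply/eqP; rewrite eq_complex /=; apply/andP; split; apply/eqP; ring.
rewrite expr1n mul1r (re_innerC e w) (orth _ _ Swk) !mulr0 addr0 sqrrN expr1n mul1r => h.
have : re_inner (e - w) (e - w) <= eps.
  by move: we; rewrite /L2norm Re_L2inner ltr_sqrt // => /ltW.
by rewrite h; apply: le_trans; rewrite lerDl re_inner_ge0.
Qed.

Lemma dom_app u : dom S u -> S u (app S u).
Proof. by move=> [f Suf]; rewrite /app; apply: xgetPex; exists f. Qed.

Lemma re_inner_null_pair_norm (p : state) e : L2_pair p -> L2 e -> re_inner e e = 0 ->
  pair_norm (p + (e, fun=> 0)) <= pair_norm p.
Proof.
move=> hp Le e0; have hq : L2_pair (e, fun=> 0) by split=> //; exact: L2_0.
apply: le_trans (pair_normD hp hq) _.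
rewrite {2}/pair_norm /pair_inner /= e0 add0r.
by rewrite /re_inner; under eq_Rintegral do rewrite /= !mul0r addr0; rewrite Rintegral_cst //
    mul0r sqrtr0 addr0.
Qed.

(** Two values of [S] at the same function differ by a value at 0, which is null by [sa_null]. The
    choice made by [app] thus drops out of the norm. *)
Lemma energy_normE U g : S U.1 g -> L2 U.2 -> energy_norm S U = pair_norm (g, U.2).
Proof.
move=> SUg LU.
have SUa : S U.1 (app S U.1) by apply: dom_app; exists g.
have [Lu Lg] := sa_L2 SUg; have [_ La] := sa_L2 SUa.
have -> : energy_norm S U = pair_norm (app S U.1, U.2).
  have ReD (a b : R[i]) : Re (a + b) = Re a + Re b by case: a; case: b.
  by rewrite /energy_norm /energy_inner ReD !Re_L2inner.
have key f f' : S U.1 f -> S U.1 f' -> pair_norm (f, U.2) <= pair_norm (f', U.2).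
  move=> Sf Sf'; have [_ Lf] := sa_L2 Sf; have [_ Lf'] := sa_L2 Sf'.
  have := sa_lin (-1) Sf' Sf; set e := fun x => -1 * f' x + f x => Se.
  have -> : (f, U.2) = (f', U.2) + (e, fun=> 0).
    congr pair; apply/funext => x; rewrite !fctE ?addr0 //.
    by rewrite /e /= mulN1r addrA subrr add0r.
  apply: re_inner_null_pair_norm; [by split|by case/sa_L2: Se|].
  apply: sa_null Se _; apply: aeW => x _ /=.
  by rewrite mulN1r addNr.
by apply/eqP; rewrite eq_le !key.
Qed.

Local Notation H := (energy_space S).
Local Notation nrm := (energy_norm S).

(** With [energy_ge0], [energyD], [energyZ_disc], [energyZ_real] and [energy_eqv], this supplies the
    seminorm hypotheses of [semigroup_resolvent_estimate]. *)
Lemma energy_lin (a : R[i]) U W : H U -> H W -> H (a *: U + W).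
Proof.
move=> [[f Sf] LU] [[g Sg] LW]; split; last exact: L2_lin.
by exists (fun x => a * f x + g x); exact: sa_lin.
Qed.

Lemma energy_pair_norm_comb U W f g (a : R[i]) : S U.1 f -> S W.1 g -> L2 U.2 -> L2 W.2 ->
  nrm (a *: U + W) = pair_norm (a *: (f, U.2) + (g, W.2)).
Proof.
move=> Sf Sg LU LW.
by apply: (@energy_normE (a *: U + W) (fun x => a * f x + g x)); [exact: sa_lin|exact: L2_lin].
Qed.

Lemma energy_ge0 U : 0 <= nrm U.
Proof. exact: sqrtr_ge0. Qed.

Lemma energyD U W : H U -> H W -> nrm (U + W) <= nrm U + nrm W.
Proof.
move=> [[f Sf] LU] [[g Sg] LW]; have [_ Lf] := sa_L2 Sf; have [_ Lg] := sa_L2 Sg.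
rewrite -{1}[U]scale1r (energy_pair_norm_comb 1 Sf Sg) // (energy_normE Sf) // (energy_normE Sg) //.
by rewrite scale1r; apply: pair_normD; split.
Qed.

Lemma energy_pair_normZ U f (a : R[i]) : S U.1 f -> L2 U.2 -> nrm (a *: U) = pair_norm (a *: (f,
    U.2)).
Proof.
move=> Sf LU.
have -> : a *: U = (a - 1) *: U + U by rewrite scalerBl scale1r subrK.
have -> : a *: (f, U.2) = (a - 1) *: (f, U.2) + (f, U.2) by rewrite scalerBl scale1r subrK.
exact: energy_pair_norm_comb.
Qed.

Lemma energyZ_disc (a : R[i]) U : unit_disc a -> H U -> nrm (a *: U) <= nrm U.
Proof.
move=> ha [[f Sf] LU]; have [_ Lf] := sa_L2 Sf.
by rewrite (energy_pair_normZ a Sf LU) (energy_normE Sf LU); apply: pair_normZ_disc.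
Qed.

Lemma energyZ_real (c : R) U : 0 <= c -> H U -> nrm (c%:C *: U) = c * nrm U.
Proof.
move=> c0 [[f Sf] LU]; have [_ Lf] := sa_L2 Sf.
by rewrite (energy_pair_normZ _ Sf LU) (energy_normE Sf LU); apply: pair_normZ_real.
Qed.

Lemma energy_eqv U W : H U -> H W -> state_eq U W -> nrm (U - W) = 0.
Proof.
move=> HU HW [UW1 UW2].
have [[f Sf] LU] := HU; have [[g Sg] LW] := HW.
have -> : U - W = (-1) *: W + U by rewrite scaleN1r addrC.
have Sd := sa_lin (-1) Sg Sf.
have LD := L2_lin (-1) LW LU.
rewrite (@energy_normE (-1 *: W + U) _ Sd LD).
rewrite /pair_norm /pair_inner /= (sa_null Sd) ?add0r; last first.
  by apply: filterS UW1 => x /= h _; rewrite -h // mulN1r addNr.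
rewrite (@ae_eq_re_inner _ _ _ (fun=> 0) _ LD (@L2_0 _ _) LD); last first.
  by apply: filterS UW2 => x /= h _; rewrite /= -h // mulN1r addNr.
by rewrite /re_inner; under eq_Rintegral do rewrite /= !mul0r addr0; rewrite Rintegral_cst //
    mul0r sqrtr0.
Qed.

End damped_wave_resolvent.

(** * The resolvent estimate for the damped wave operator *)

Section stable_resolvent.
Local Open Scope complex_scope.
Variables (R : realType) (d : nat).
Local Notation E := 'rV[R]_d.
Local Notation mu := (lebesgue_rV R d).
Local Notation Re := complex.Re.
Local Notation Im := complex.Im.
Local Notation state := ((E -> R[i]) * (E -> R[i]))%type.

Lemma L2_mul_Linf (b : E -> R) (u : E -> R[i]) : b \in Lfun mu +oo%E -> L2 u -> L2 (fun x => (b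
    x)%:C * u x).
Proof.
move=> /Linf_ae_bounded[mb [M M0 bM]] [u1 u2].
have mu1 : measurable_fun setT (fun x => Re (u x)) by have /Lfun2P[] := u1.
have mu2 : measurable_fun setT (fun x => Im (u x)) by have /Lfun2P[] := u2.
split.
  rewrite (_ : (fun x => _) = fun x => b x * Re (u x)); last first.
    by apply/funext => x; case: (u x) => ? ? /=; ring.
  apply: (@Lfun2_dominated _ _ _ _ M _ u1); first exact: measurable_funM.
  by apply: filterS bM => x h; rewrite normrM ler_wpM2r.
rewrite (_ : (fun x => _) = fun x => b x * Im (u x)); last first.
  by apply/funext => x; case: (u x) => ? ? /=; ring.
apply: (@Lfun2_dominated _ _ _ _ M _ u2); first exact: measurable_funM.
by apply: filterS bM => x h; rewrite normrM ler_wpM2r.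
Qed.

(** With W = (w, i om w), the vector (A_b - i om) W is (0, v). On the left only the second component
    of [W] is kept. [K] is a squared norm bound. *)
Lemma stable_resolvent (V b : E -> R) : b \in Lfun mu +oo%E -> uniformly_stable V b ->
  exists2 K : R, 0 < K & forall (om : R) (w f v : E -> R[i]), schrodinger V w f ->
    (forall x, v x = - f x - (b x)%:C * ((0 +i* om) * w x) - (0 +i* om) * ((0 +i* om) * w x)) ->
    om ^+ 2 * re_inner w w <= K * re_inner v v.
Proof.
move=> bLinf [S [T [[saS _ PS] semT gen [C [tau [C0 tau0 decay]]]]]].
(* At this time the decay factor is C exp(-2 C) <= 1 / 2, because exp(2 C) >= 1 + 2 C; the term in
   |W| on the right is then absorbed. *)
pose t := 2 * C * tau.
have t0 : 0 < t by rewrite !mulr_gt0.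
have Chalf : C * expR (- t / tau) <= 2^-1.
  have -> : - t / tau = - (2 * C) by rewrite /t; field; rewrite gt_eqF.
  rewrite expRN ler_pdivrMr ?expR_gt0 //.
  have := expR_ge1Dx (2 * C); lra.
exists ((2 * t * C) ^+ 2); first by rewrite exprn_gt0 // !mulr_gt0.
move=> om w f v Pwf vE.
have [Lw Lf _] := Pwf.
(* As P is the square of [S], a function in the domain of P also lies in that of [S]; this places
   [W] in the domain of the generator. *)
have [g Swg Sgf] := (PS _ _).1 Pwf.
have Siw : S (fun x => (0 +i* om) * w x) (fun x => (0 +i* om) * g x).
  exact: sa_Z.
pose W : state := (w, fun x => (0 +i* om) * w x).
pose Z : state := (fun x => (0 +i* om) * w x, fun x => - f x - (b x)%:C * ((0 +i* om) * w x)).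
have LW2 : L2 W.2 by exact: L2Z.
have LZ2 : L2 Z.2.
  rewrite (_ : Z.2 = fun x => (-1) * (1 * f x + (b x)%:C * W.2 x) + 0).
    exact: L2_lin (L2_lin 1 Lf (L2_mul_Linf bLinf LW2)) (@L2_0 R d).
  by apply/funext => x; rewrite /= addr0 mul1r mulN1r opprD.
have HW : energy_space S W by split=> //; exists g.
have HZ : energy_space S Z by split=> //; exists (fun x => (0 +i* om) * g x).
have WZ : generator (energy_space S) (energy_norm S) T W Z.
  apply/gen; split => //; first by exists (fun x => (0 +i* om) * g x).
  by exists f => //; split; apply: aeW.
have est := semigroup_resolvent_estimate (energy_lin saS) (@energy_ge0 R d S) (energyD saS)
    (energyZ_disc saS) (energyZ_real saS) (energy_eqv saS) semT C0 tau0 decay om t0 WZ.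
have nW0 : 0 <= energy_norm S W by exact: sqrtr_ge0.
have est2 : energy_norm S W <= 2 * t * C * energy_norm S (Z - (0 +i* om) *: W).
  have h : C * expR (- t / tau) * energy_norm S W <= 2^-1 * energy_norm S W by rewrite ler_wpM2r.
  have -> : 2 * t * C * energy_norm S (Z - (0 +i* om) *: W) = 2 * (t * (C * energy_norm S (Z - (0
      +i* om) *: W))) by ring.
  have arith (x y z : R) : y <= x + z -> x <= 2^-1 * y -> y <= 2 * z by lra.
  exact: arith est h.
have low : om ^+ 2 * re_inner w w <= energy_norm S W ^+ 2.
  rewrite (@energy_normE _ _ _ saS W g Swg LW2) /pair_norm sqr_sqrtr ?pair_inner_ge0 //
      /pair_inner /=.
  by rewrite re_innerZZ //= expr0n add0r lerDr re_inner_ge0.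
have Lv : L2 v.
  rewrite (_ : v = fun x => - (0 +i* om) * W.2 x + Z.2 x); first exact: L2_lin.
  by apply/funext => x; rewrite vE mulNr addrC.
have up : energy_norm S (Z - (0 +i* om) *: W) ^+ 2 = re_inner v v.
  have -> : Z - (0 +i* om) *: W = (fun=> 0, v).
    congr pair; apply/funext => x; last by rewrite vE.
    by rewrite !fctE subrr.
  have S0 := sa_0 saS Swg.
  rewrite (@energy_normE _ _ _ saS (fun=> 0, v) _ S0 Lv) /pair_norm sqr_sqrtr ?pair_inner_ge0 //
      /pair_inner /=.
  by rewrite (sa_null saS S0) ?add0r //; exact: aeW.
apply: le_trans low _; rewrite -up -exprMn lerXn2r // ?nnegrE ?sqrtr_ge0 //.
by rewrite !mulr_ge0 ?sqrtr_ge0 // ltW.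
Qed.

End stable_resolvent.

(** * Phases, products under the Laplacian, and the weak Schrodinger equation *)

Section quasimode.
Local Open Scope complex_scope.
Variables (R : realType) (d : nat).
Local Notation E := 'rV[R]_d.
Local Notation mu := (lebesgue_rV R d).
Local Notation Re := complex.Re.
Local Notation Im := complex.Im.
Local Notation e_ i := (delta_mx ord0 i : 'rV[R]_d).

Lemma is_derive_add (f g : E -> R) (x v : E) (df dg : R) : is_derive x v f df -> is_derive x v g
    dg ->
  is_derive x v (fun y => f y + g y) (df + dg).
Proof. by move=> hf hg; exact: is_deriveD. Qed.

Lemma is_derive_mul (f g : E -> R) (x v : E) (df dg : R) : is_derive x v f df -> is_derive x v g
    dg ->
  is_derive x v (fun y => f y * g y) (f x * dg + g x * df).
Proof. by move=> hf hg; exact: is_deriveM. Qed.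

Lemma is_derive_scale (c : R) (f : E -> R) (x v : E) (df : R) : is_derive x v f df ->
  is_derive x v (fun y => c * f y) (c * df).
Proof. by move=> hf; exact: is_deriveZ. Qed.

Lemma is_derive_bigsum (I : Type) (r : seq I) (F : I -> E -> R) (dF : I -> R) (x v : E) :
  (forall i, is_derive x v (F i) (dF i)) ->
  is_derive x v (fun y => \sum_(i <- r) F i y) (\sum_(i <- r) dF i).
Proof.
move=> hF; elim: r => [|i r IH].
  by under eq_fun do rewrite big_nil; rewrite big_nil; exact: is_derive_cst.
by under eq_fun do rewrite big_cons; rewrite big_cons; exact: is_derive_add.
Qed.

Definition dot (nu x : E) : R := \sum_(i < d) nu ord0 i * x ord0 i.

Lemma is_derive_dot (nu x v : E) : is_derive x v (dot nu) (dot nu v).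
Proof. by apply: is_derive_bigsum => i; apply: is_derive_scale; exact: is_derive_coord. Qed.

Lemma dot_basis (nu : E) i : dot nu (e_ i) = nu ord0 i.
Proof.
rewrite /dot (bigD1 i) //= mxE !eqxx mulr1 big1 ?addr0 // => j ji.
by rewrite mxE eqxx (negbTE ji) mulr0.
Qed.

Lemma Cn_dot n (nu : E) : Cn n (dot nu).
Proof. by apply: Cn_sum => i; apply: CnZ; exact: Cn_coord. Qed.

(* The successive derivatives of [cos], so that [trig 3] is [sin]. *)
Definition trig (k : nat) : R -> R :=
  fun t => match (k %% 4)%N with 0 => cos t | 1 => - sin t | 2 => - cos t | _ => sin t end.

Lemma continuous_trig k : continuous (trig k).
Proof.
move=> t; rewrite /trig; case: (k %% 4)%N => [|[|[|_]]].
- exact: continuous_cos.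
- by apply: cvgN; exact: continuous_sin.
- by apply: cvgN; exact: continuous_cos.
- exact: continuous_sin.
Qed.

Lemma is_derive_trig k (t : R) : is_derive t (1:R) (trig k) (trig k.+1 t).
Proof.
have kE : (k.+1 %% 4 = (k %% 4).+1 %% 4)%N by rewrite -[in RHS]addn1 modnDml addn1.
have : (k %% 4 < 4)%N by rewrite ltn_mod.
rewrite /trig kE; case: (k %% 4)%N => [|[|[|[|//]]]] _ /=.
- exact: is_derive_cos.
- have h := is_derive_sin t; exact: is_deriveN.
- have h := is_derive_cos t.
  by rewrite -[sin t]opprK; exact: is_deriveN.
- exact: is_derive_sin.
Qed.

Lemma Cn_cos n (p : E -> R) : Cn n p -> Cn n (fun x => cos (p x)).
Proof.
by move=> Cp; apply: (Cn_comp (g := trig)) => //; [exact: continuous_trig|move=> k u _; exact: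
    is_derive_trig].
Qed.

Lemma Cn_sin n (p : E -> R) : Cn n p -> Cn n (fun x => sin (p x)).
Proof.
move=> Cp; apply: (Cn_comp (g := fun k => trig (3 + k))) => //; first by move=> k; exact:
    continuous_trig.
by move=> k u _; rewrite addnS; exact: is_derive_trig.
Qed.

Lemma laplacianM (f g : E -> R) x : Cn 2 f -> Cn 2 g ->
  laplacian (fun y => f y * g y) x =
  laplacian f x * g x + 2 * (\sum_(i < d) partial i f x * partial i g x) + f x * laplacian g x.
Proof.
move=> Cf Cg.
have P1 i : partial i (fun y => f y * g y) = fun y => f y * partial i g y + g y * partial i f y.
  by apply/funext => y; apply: partial_val; apply: is_derive_mul; [exact: Cn_is_derive Cf|exact:
      Cn_is_derive Cg].
rewrite /laplacian mulr_suml mulr_sumr mulr_sumr -!big_split /=; apply: eq_bigr => i _.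
have h1 := Cn_is_derive i x Cf; have h2 := Cn_is_derive i x Cg.
have h3 := Cn_is_derive i x (Cn_partial i Cf); have h4 := Cn_is_derive i x (Cn_partial i Cg).
rewrite P1 (partial_val (is_derive_add (is_derive_mul h1 h4) (is_derive_mul h2 h3))).
move: (f x) (g x) (partial i (partial i f) x) (partial i (partial i g) x) (partial i f x)
    (partial i g x).
by move=> a b c e p q; ring.
Qed.

Lemma continuous_bounded_support_Lfun2 (f : E -> R) : continuous f -> bounded_support f -> f \in
    Lfun mu 2%:E.
Proof.
move=> cf sf; apply/Lfun2P; split; first exact: continuous_measurable_rV.
rewrite (_ : (fun x => _) = fun x => f x * f x); last by apply/funext => x; rewrite expr2.
apply: continuous_bounded_support_integrable; [exact: continuous_mul|exact: bounded_supportMl].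
Qed.

Lemma test_function_bounded_support (phi : E -> R) : test_function phi -> bounded_support phi.
Proof.
move=> [_ /compact_bounded[M [_ hM]]].
exists (`|M| + 2) => [|x nx]; first by rewrite ltr_wpDl.
apply/eqP; apply/negPn/negP => px; apply: nx => i.
apply: le_lt_trans (le_coord_norm x i) _.
apply: le_lt_trans (hM (`|M| + 1) _ x _) _; last by rewrite ltrD2l ltr1n.
  by rewrite ltr_pwDr // ler_norm.
exact: subset_closure.
Qed.

(** [V] is essentially bounded on a closed cube outside which [g] vanishes. *)
Lemma Linf_loc_mul (V g : E -> R) : Linf_loc V -> continuous g -> bounded_support g ->
  (fun x => V x * g x) \in Lfun mu 2%:E.
Proof.
move=> [mV locV] cg sg; have [r r0 gr] := sg.
have [mVK [M M0 VM]] := Linf_ae_bounded (locV _ (@compact_closed_cube R d r)).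
have mg := continuous_measurable_rV cg.
apply: (@Lfun2_dominated _ _ _ _ M _ (continuous_bounded_support_Lfun2 cg sg)); first exact:
    measurable_funM.
apply: filterS VM => x; rewrite /patch; case: ifPn => [_ h|/negP xr _].
  by rewrite normrM ler_wpM2r.
rewrite gr ?mulr0 ?normr0 ?mulr0 // => xc; apply: xr.
by rewrite inE => i; exact: ltW.
Qed.

Lemma laplacian_continuous (g : E -> R) : Cn 2 g -> continuous (laplacian g).
Proof.
move=> Cg; apply: (@Cn_continuous _ _ 0); rewrite /laplacian.
by apply: Cn_sum => i; do 2 apply: Cn_partial.
Qed.

Lemma laplacian_bounded_support (g : E -> R) : bounded_support g -> bounded_support (laplacian g).
Proof.
by move=> sg; apply: bounded_support_sum => i; do 2 apply: bounded_support_derive.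
Qed.

(** The potential term is the same on both sides and Green's identity moves the Laplacian. Hence a
    C^2 function of bounded support has its classical image as value of P. *)
Lemma schrodinger_weak (V g phi : E -> R) : Linf_loc V -> Cn 2 g -> bounded_support g ->
    test_function phi ->
  \int[mu]_x (g x * (V x * phi x - 2^-1 * laplacian phi x)) =
  \int[mu]_x ((V x * g x - 2^-1 * laplacian g x) * phi x).
Proof.
move=> HV Cg sg tphi; have sphi := test_function_bounded_support tphi; have Cphi : Cn 2 phi by
    exact: tphi.1.
have cg := Cn_continuous Cg; have cphi := Cn_continuous Cphi.
have clg := laplacian_continuous Cg; have clphi := laplacian_continuous Cphi.
have g2 := continuous_bounded_support_Lfun2 cg sg.
have phi2 := continuous_bounded_support_Lfun2 cphi sphi.
have lg2 := continuous_bounded_support_Lfun2 clg (laplacian_bounded_support sg).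
have lphi2 := continuous_bounded_support_Lfun2 clphi (laplacian_bounded_support sphi).
have Vg2 := Linf_loc_mul HV cg sg.
have i1 := Lfun2_mul_integrable Vg2 phi2.
have i2 := Lfun2_mul_integrable g2 lphi2.
have i3 := Lfun2_mul_integrable lg2 phi2.
have Zi (c : R) (h : E -> R) : mu.-integrable setT (EFin \o h) -> mu.-integrable setT (EFin \o
    (fun x => c * h x)).
  by move=> ih; exact: (integrableZl measurableT c ih).
transitivity (\int[mu]_x ((V x * g x * phi x) + (- 2^-1) * (g x * laplacian phi x))).
  by apply: eq_Rintegral => x _; ring.
rewrite RintegralD //; last exact: Zi.
rewrite RintegralZl // (Rintegral_laplacian Cg Cphi sg).
transitivity (\int[mu]_x ((V x * g x * phi x) + (- 2^-1) * (laplacian g x * phi x))).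
  rewrite RintegralD //; last exact: Zi.
  by rewrite RintegralZl.
by apply: eq_Rintegral => x _; ring.
Qed.

End quasimode.

(** * Wave packets and the high-frequency limit *)

Section quasimode_estimate.
Local Open Scope complex_scope.
Variables (R : realType) (d : nat).
Local Notation E := 'rV[R]_d.
Local Notation mu := (lebesgue_rV R d).
Local Notation Re := complex.Re.
Local Notation Im := complex.Im.
Local Notation e_ i := (delta_mx ord0 i : 'rV[R]_d).

(** The derivative nu.grad a, in the form that the cross term of [laplacianM] produces. *)
Definition grad_along (nu : E) (a : E -> R) (x : E) : R := \sum_(i < d) nu ord0 i * partial i a x.

Section wave_packet.
Variables (nu : E) (lam : R) (a : E -> R).
Hypotheses (nu1 : dot nu nu = 1) (Ca : Cn 2 a) (sa : bounded_support a).

Definition phase (x : E) := lam * dot nu x.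

Lemma Cn_phase n : Cn n phase.
Proof. by apply: CnZ; exact: Cn_dot. Qed.

Lemma is_derive_phase i x : is_derive x (e_ i) phase (lam * nu ord0 i).
Proof. by rewrite -[nu ord0 i]dot_basis; apply: is_derive_scale; exact: is_derive_dot. Qed.

Lemma partial_cos i x : partial i (fun y => cos (phase y)) x = (lam * nu ord0 i) * - sin (phase x).
Proof.
by apply: partial_val; apply: (is_derive_comp1 (is_derive_phase i _) (is_derive_cos _)).
Qed.

Lemma partial_sin i x : partial i (fun y => sin (phase y)) x = (lam * nu ord0 i) * cos (phase x).
Proof.
by apply: partial_val; apply: (is_derive_comp1 (is_derive_phase i _) (is_derive_sin _)).
Qed.

Lemma laplacian_cos x : laplacian (fun y => cos (phase y)) x = - lam ^+ 2 * cos (phase x).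
Proof.
(* A factor |nu|^2 = 1 is inserted on the right so that the two sides can be compared coordinate by
   coordinate. *)
rewrite /laplacian -[RHS]mulr1 -[X in _ = _ * X]nu1 /dot mulr_sumr; apply: eq_bigr => i _.
rewrite (_ : partial i (fun y => cos (phase y)) = fun y => (- (lam * nu ord0 i)) * sin (phase
    y)); last first.
  by apply/funext => y; rewrite partial_cos; ring.
have -> : partial i (fun y => - (lam * nu ord0 i) * sin (phase y)) x = - (lam * nu ord0 i) *
    ((lam * nu ord0 i) * cos (phase x)).
  by apply: partial_val; apply: is_derive_scale; apply: (is_derive_comp1 (is_derive_phase i _)
      (is_derive_sin _)).
by ring.
Qed.

Lemma laplacian_sin x : laplacian (fun y => sin (phase y)) x = - lam ^+ 2 * sin (phase x).
Proof.
rewrite /laplacian -[RHS]mulr1 -[X in _ = _ * X]nu1 /dot mulr_sumr; apply: eq_bigr => i _.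
rewrite (_ : partial i (fun y => sin (phase y)) = fun y => (lam * nu ord0 i) * cos (phase y));
    last first.
  by apply/funext => y; rewrite partial_sin.
have -> : partial i (fun y => (lam * nu ord0 i) * cos (phase y)) x = (lam * nu ord0 i) * ((lam *
    nu ord0 i) * - sin (phase x)).
  by apply: partial_val; apply: is_derive_scale; apply: (is_derive_comp1 (is_derive_phase i _)
      (is_derive_cos _)).
by ring.
Qed.

Lemma laplacian_cos_amplitude x : laplacian (fun y => cos (phase y) * a y) x =
  cos (phase x) * (laplacian a x - lam ^+ 2 * a x) - 2 * lam * sin (phase x) * grad_along nu a x.
Proof.
have Cp : Cn 2 (fun y => cos (phase y)) by apply: Cn_cos; exact: Cn_phase.
rewrite (laplacianM x Cp Ca).
rewrite laplacian_cos.
rewrite (_ : \sum_(i < d) _ = - lam * sin (phase x) * grad_along nu a x); first by ring.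
by rewrite /grad_along mulr_sumr; apply: eq_bigr => i _; rewrite partial_cos; ring.
Qed.

Lemma laplacian_sin_amplitude x : laplacian (fun y => sin (phase y) * a y) x =
  sin (phase x) * (laplacian a x - lam ^+ 2 * a x) + 2 * lam * cos (phase x) * grad_along nu a x.
Proof.
have Cp : Cn 2 (fun y => sin (phase y)) by apply: Cn_sin; exact: Cn_phase.
rewrite (laplacianM x Cp Ca).
rewrite laplacian_sin.
rewrite (_ : \sum_(i < d) _ = lam * cos (phase x) * grad_along nu a x); first by ring.
by rewrite /grad_along mulr_sumr; apply: eq_bigr => i _; rewrite partial_sin; ring.
Qed.

(** The function exp(i lam nu.x) a(x), by components so that the real calculus applies to each. *)
Definition packet (x : E) : R[i] := (cos (phase x) * a x) +i* (sin (phase x) * a x).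

Definition packet_image (V : E -> R) (x : E) : R[i] :=
  (V x * (cos (phase x) * a x) - 2^-1 * laplacian (fun y => cos (phase y) * a y) x) +i*
  (V x * (sin (phase x) * a x) - 2^-1 * laplacian (fun y => sin (phase y) * a y) x).

Lemma packet_schrodinger V : Linf_loc V -> schrodinger V packet (packet_image V).
Proof.
move=> HV.
have Cc : Cn 2 (fun y => cos (phase y) * a y) by apply: CnM Ca; apply: Cn_cos; exact: Cn_phase.
have Cs : Cn 2 (fun y => sin (phase y) * a y) by apply: CnM Ca; apply: Cn_sin; exact: Cn_phase.
have sc : bounded_support (fun y => cos (phase y) * a y) by exact: bounded_supportMr.
have ss : bounded_support (fun y => sin (phase y) * a y) by exact: bounded_supportMr.
have im2 g : Cn 2 g -> bounded_support g -> (fun x => V x * g x - 2^-1 * laplacian g x) \in Lfun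
    mu 2%:E.
  move=> Cg sg; rewrite (_ : (fun x => _) = fun x => V x * g x + (- 2^-1) * laplacian g x); last
      first.
    by apply/funext => x; rewrite mulNr.
  apply: Lfun2D; first exact: (Linf_loc_mul HV (Cn_continuous Cg) sg).
  apply: Lfun2Z; exact: continuous_bounded_support_Lfun2 (laplacian_continuous Cg)
      (laplacian_bounded_support sg).
split.
- split; [exact: continuous_bounded_support_Lfun2 (Cn_continuous Cc) sc|exact:
    continuous_bounded_support_Lfun2 (Cn_continuous Cs) ss].
- by split; [exact: im2 Cc sc|exact: im2 Cs ss].
have ReM (p q z : R) : Re ((p +i* q) * z%:C) = p * z by rewrite /= mulr0 subr0.
have ImM (p q z : R) : Im ((p +i* q) * z%:C) = q * z by rewrite /= mulr0 add0r.
move=> phi tphi; rewrite /cintegral; congr (_ +i* _).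
  under eq_Rintegral do rewrite ReM; under [RHS]eq_Rintegral do rewrite ReM.
  exact: schrodinger_weak HV Cc sc tphi.
under eq_Rintegral do rewrite ImM; under [RHS]eq_Rintegral do rewrite ImM.
exact: schrodinger_weak HV Cs ss tphi.
Qed.

Lemma packet_re_inner : re_inner packet packet = \int[mu]_x (a x ^+ 2).
Proof.
apply: eq_Rintegral => x _ /=.
by rewrite -[RHS]mul1r -(cos2Dsin2 (phase x)); ring.
Qed.

(** The relation lam^2 = 2 om^2 cancels lam^2 a / 2 against om^2 a. What remains is exp(i lam nu.x)
    times (Delta a / 2 - V a) + i (lam nu.grad a - om b a), and the phase has modulus 1. *)
Lemma packet_residual V b om x : lam ^+ 2 = 2 * om ^+ 2 ->
  let v := - packet_image V x - (b x)%:C * ((0 +i* om) * packet x) - (0 +i* om) * ((0 +i* om) *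
      packet x) in
  Re v * Re v + Im v * Im v =
  (2^-1 * laplacian a x - V x * a x) ^+ 2 + (lam * grad_along nu a x - om * (b x * a x)) ^+ 2.
Proof.
move=> lamE; rewrite /packet_image /packet laplacian_cos_amplitude laplacian_sin_amplitude /= lamE.
move: (cos2Dsin2 (phase x)).
move: (cos _) (sin _) (laplacian _ _) (grad_along _ _ _) => c s L D cs.
transitivity ((c ^+ 2 + s ^+ 2) * ((2^-1 * L - V x * a x) ^+ 2 + (lam * D - om * (b x * a x)) ^+
    2)).
  by field.
by rewrite cs mul1r.
Qed.

End wave_packet.

(** Only the coefficient of om^2 survives, as the other part of the residual does not depend on om.
    Extended integrals are used because the bound is later integrated over a parameter by
    Tonelli. *)
Lemma stable_amplitude (V b : E -> R) : Linf_loc V -> b \in Lfun mu +oo%E -> uniformly_stable V b ->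
  exists2 K : R, 0 < K & forall (nu : E) (a : E -> R), dot nu nu = 1 -> Cn 2 a -> bounded_support
      a ->
    (\int[mu]_x (a x ^+ 2)%:E <= K%:E * \int[mu]_x ((Num.sqrt 2 * grad_along nu a x - b x * a x)
        ^+ 2)%:E)%E.
Proof.
move=> HV bL st; have [K K0 HK] := stable_resolvent bL st.
exists K => // nu a nu1 Ca sa.
have ca := Cn_continuous Ca.
have a2 := continuous_bounded_support_Lfun2 ca sa.
have L2a : (fun x => 2^-1 * laplacian a x - V x * a x) \in Lfun mu 2%:E.
  rewrite (_ : (fun x => _) = fun x => 2^-1 * laplacian a x + (-1) * (V x * a x)); last first.
    by apply/funext => x; rewrite mulN1r.
  apply: Lfun2D; apply: Lfun2Z; last exact: Linf_loc_mul.
  exact: continuous_bounded_support_Lfun2 (laplacian_continuous Ca) (laplacian_bounded_support sa).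
have Cga : Cn 1 (grad_along nu a) by apply: Cn_sum => i; apply: CnZ; exact: Cn_partial.
have sga : bounded_support (grad_along nu a).
  by apply: bounded_support_sum => i; apply: bounded_supportMr; exact: bounded_support_derive.
have ba2 : (fun x => b x * a x) \in Lfun mu 2%:E.
  have [mb [M M0 bM]] := Linf_ae_bounded bL.
  apply: (@Lfun2_dominated _ _ _ _ M _ a2).
    by apply: measurable_funM => //; exact: continuous_measurable_rV.
  by apply: filterS bM => x h; rewrite normrM ler_wpM2r.
have G2 : (fun x => Num.sqrt 2 * grad_along nu a x - b x * a x) \in Lfun mu 2%:E.
  rewrite (_ : (fun x => _) = fun x => Num.sqrt 2 * grad_along nu a x + (-1) * (b x * a x)); last
      first.
    by apply/funext => x; rewrite mulN1r.
  apply: Lfun2D; apply: Lfun2Z => //.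
  by exact: continuous_bounded_support_Lfun2 (Cn_continuous Cga) sga.
have fE (h : E -> R) : h \in Lfun mu 2%:E -> (\int[mu]_x (h x ^+ 2)%:E = (\int[mu]_x (h x ^+
    2))%:E)%E.
  by move=> /Lfun2P[_ i]; rewrite fineK //; exact: integrable_fin_num.
rewrite (fE _ a2) (fE _ G2) -EFinM lee_fin.
set I1 := \int[mu]_x _; set I2 := \int[mu]_x _.
pose I3 := \int[mu]_x ((2^-1 * laplacian a x - V x * a x) ^+ 2).
have key om : om ^+ 2 * I1 <= K * (I3 + om ^+ 2 * I2).
  have lamE : (Num.sqrt 2 * om) ^+ 2 = 2 * om ^+ 2 by rewrite exprMn sqr_sqrtr.
  have := HK om _ _ _ (packet_schrodinger nu (Num.sqrt 2 * om) Ca sa HV) (fun x => erefl).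
  rewrite packet_re_inner; congr (_ <= K * _).
  rewrite /re_inner; under eq_Rintegral do rewrite (packet_residual nu1 Ca _ _ _ lamE).
  rewrite -RintegralZl //; last by have /Lfun2P[] := G2.
  rewrite -RintegralD //; last first.
  - have /Lfun2P[_ i] := G2; exact: (integrableZl measurableT (om ^+ 2) i).
  - by have /Lfun2P[] := L2a.
  by apply: eq_Rintegral => x _; ring.
have I30 : 0 <= I3 by apply: Rintegral_ge0 => x _; exact: sqr_ge0.
apply/ler_addgt0Pr => e e0.
(* Chosen so that om^2 e = K I3 + e: the potential term, divided by om^2, is then below [e]. The
   summand 1 keeps om^2 positive. *)
pose om := Num.sqrt (K * I3 / e + 1).
have om2 : om ^+ 2 = K * I3 / e + 1.
  by rewrite sqr_sqrtr // addr_ge0 // divr_ge0 // ?mulr_ge0 // ltW.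
have omp : 0 < om ^+ 2 by rewrite om2 ltr_wpDl // divr_ge0 ?mulr_ge0 // ltW.
rewrite -(ler_pM2l omp); apply: le_trans (key om) _.
have he : om ^+ 2 * e = K * I3 + e by rewrite om2 mulrDl divfK ?gt_eqF // mul1r.
have -> : om ^+ 2 * (K * I2 + e) = K * (I3 + om ^+ 2 * I2) + e by rewrite mulrDr he; ring.
by rewrite lerDl ltW.
Qed.

End quasimode_estimate.

(** * Powers of the positive part *)

Section cubic_cutoff.
Variable R : realType.

Definition pos (u : R) : R := Num.max 0 u.

Lemma pos_ge0 u : 0 <= pos u. Proof. by rewrite /pos le_max lexx. Qed.

Lemma pos_continuous : continuous pos.
Proof. by move=> u; apply: continuous_max; [exact: cst_continuous|exact: cvg_id]. Qed.

(** A remainder of order h^2 yields the derivative; this treats the kink of [pos] at 0 together with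
    all other points. *)
Lemma is_derive_quadratic (g : R -> R) (u dg C : R) :
  (forall h, `|h| <= 1 -> `|g (u + h) - g u - h * dg| <= C * h ^+ 2) -> is_derive u (1:R) g dg.
Proof.
move=> H.
have cv : (fun h => h^-1 *: ((g \o shift u) (h *: (1:R)) - g u)) @ (0 : R)^' --> dg.
  apply/cvgrPdist_le => e e0.
  near=> h.
  have h0 : h != 0 by near: h; exact: nbhs_dnbhs_neq.
  have h1 : `|h| <= 1.
    near: h; apply: dnbhs0_le => //.
  have h2 : `|h| <= e / (`|C| + 1).
    by near: h; apply: dnbhs0_le; rewrite divr_gt0 // ltr_wpDl.
  rewrite /= [h *: 1]mulr1 (addrC h) /GRing.scale /=.
  have -> : dg - h^-1 * (g (u + h) - g u) = - h^-1 * (g (u + h) - g u - h * dg) by field.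
  rewrite normrM normrN normfV ler_pdivrMl ?normr_gt0 //.
  apply: le_trans (H h h1) _.
  rewrite -(real_normK (num_real h)) expr2 mulrCA ler_wpM2l //.
  apply: (@le_trans _ _ ((`|C| + 1) * `|h|)).
    by rewrite ler_wpM2r // (le_trans (ler_norm C)) // lerDl.
  by rewrite -ler_pdivlMl ?ltr_wpDl // mulrC.
split; first by apply/cvg_ex; exists dg.
exact: cvg_lim.
Unshelve. all: by end_near. Qed.

Lemma is_derive_pos2 (u : R) : is_derive u (1:R) (fun t => pos t ^+ 2) (2 * pos u).
Proof.
apply: (@is_derive_quadratic _ _ _ 1) => h _; rewrite /pos mul1r ler_norml.
case: (leP 0 u) => u0; case: (leP 0 (u + h)) => uh.
- have -> : (u + h) ^+ 2 - u ^+ 2 - h * (2 * u) = h ^+ 2 by ring.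
  by rewrite lexx andbT; have := sqr_ge0 h; lra.
(* Here 0 lies between u + h and u, so |u + h| <= |h|. *)
- have -> : 0 ^+ 2 - u ^+ 2 - h * (2 * u) = h ^+ 2 - (u + h) ^+ 2 by ring.
  have : (u + h) ^+ 2 <= h ^+ 2 by nra.
  by have := sqr_ge0 (u + h); lra.
- have -> : (u + h) ^+ 2 - 0 ^+ 2 - h * (2 * 0) = (u + h) ^+ 2 by ring.
  have : (u + h) ^+ 2 <= h ^+ 2 by nra.
  by have := sqr_ge0 (u + h); lra.
- have -> : 0 ^+ 2 - 0 ^+ 2 - h * (2 * 0) = 0 :> R by ring.
  by have := sqr_ge0 h; lra.
Qed.

Lemma is_derive_pos3 (u : R) : is_derive u (1:R) (fun t => pos t ^+ 3) (3 * pos u ^+ 2).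
Proof.
apply: (@is_derive_quadratic _ _ _ (3 * `|u| + 3)) => h; rewrite ler_norml => /andP[h1 h2].
(* Each remainder is a factor bounded with the help of |h| <= 1 times a square of at most h^2; when
   u and u + h have opposite signs, neither exceeds |h| in size. *)
have key (X Y : R) : `|X| <= 3 * `|u| + 3 -> 0 <= Y -> Y <= h ^+ 2 -> `|X * Y| <= (3 * `|u| + 3)
    * h ^+ 2.
  by move=> X1 Y0 Y1; rewrite normrM (ger0_norm Y0) ler_pM.
rewrite /pos; case: (leP 0 u) => u0; case: (leP 0 (u + h)) => uh.
- have -> : (u + h) ^+ 3 - u ^+ 3 - h * (3 * u ^+ 2) = (3 * u + h) * h ^+ 2 by ring.
  by apply: key => //; [rewrite (ger0_norm u0) ler_norml; lra|exact: sqr_ge0].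
- have -> : 0 ^+ 3 - u ^+ 3 - h * (3 * u ^+ 2) = (- u - 3 * h) * u ^+ 2 by ring.
  by apply: key; [rewrite (ger0_norm u0) ler_norml; lra|exact: sqr_ge0|nra].
- have -> : (u + h) ^+ 3 - 0 ^+ 3 - h * (3 * 0 ^+ 2) = (u + h) * (u + h) ^+ 2 by ring.
  by apply: key; [rewrite (ltr0_norm u0) ler_norml; lra|exact: sqr_ge0|nra].
- have -> : 0 ^+ 3 - 0 ^+ 3 - h * (3 * 0 ^+ 2) = 0 * h ^+ 2 :> R by ring.
  by apply: key => //; [rewrite (ltr0_norm u0) ler_norml; lra|exact: sqr_ge0].
Qed.

Variable d : nat.
Local Notation E := 'rV[R]_d.

Lemma Cn_pos3 (p : E -> R) : Cn 2 p -> Cn 2 (fun x => pos (p x) ^+ 3).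
Proof.
move=> Cp.
(* The cube is the lowest integer power of [pos] of class C^2. The value 0 from rank 3 on is filler:
   differentiability is asked only at ranks 0 and 1. *)
pose g k (t : R) : R := match k with 0 => pos t ^+ 3 | 1 => 3 * pos t ^+ 2 | 2 => 6 * pos t | _
    => 0 end.
have cX k : continuous (fun t => pos t ^+ k).
  by move=> t; apply: (@continuous_comp _ _ _ pos (fun x => x ^+ k)); [exact:
      pos_continuous|exact: exprn_continuous].
apply: (Cn_comp (g := g)) => //.
- case=> [|[|[|k]]] t; rewrite /g.
  + exact: cX.
  + by apply: cvgMr; exact: cX.
  + by apply: cvgMr; exact: pos_continuous.
  + exact: cst_continuous.
- case=> [|[|//]] t _; rewrite /g; first exact: is_derive_pos3.
  rewrite (_ : 6 * pos t = 3 * (2 * pos t)); last by ring.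
  have h := is_derive_pos2 t; exact: is_deriveZ.
Qed.

End cubic_cutoff.

(** * The moving amplitude and its derivative along the line *)

Section amplitude.
Variables (R : realType) (d : nat).
Local Notation E := 'rV[R]_d.
Local Notation e_ i := (delta_mx ord0 i : 'rV[R]_d).

Definition psi (T t : R) : R := pos (1 + - T ^- 2 * (t * t)) ^+ 3.

(** The derivative of [psi T], as the chain rule and [is_derive_pos3] give it. *)
Definition dpsi (T t : R) : R := 3 * pos (1 + - T ^- 2 * (t * t)) ^+ 2 * (- T ^- 2 * (2 * t)).

Definition chi (r : R) (z : E) : R := pos (1 + - r ^- 2 * dot z z) ^+ 3.

(** This is the amplitude a_s. Moving [x] along [nu] raises t = nu.x + s at unit speed, which leaves
    x - x0 - t nu fixed. *)
Definition tube (T r : R) (x0 nu : E) (s : R) (x : E) : R :=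
  psi T (dot nu x + s) * chi r (x - x0 - (dot nu x + s) *: nu).

Section tube_derivatives.
Variables (T r : R) (x0 nu : E) (s : R).
Hypotheses (T0 : 0 < T) (r0 : 0 < r) (nu1 : dot nu nu = 1).

Let tau (x : E) := dot nu x + s.
Let z (j : 'I_d) (x : E) := x ord0 j + (- nu ord0 j * tau x + - x0 ord0 j).
Let p1 (x : E) := 1 + - T ^- 2 * (tau x * tau x).
Let p2 (x : E) := 1 + - r ^- 2 * \sum_(j < d) z j x * z j x.

Let tubeE : tube T r x0 nu s = fun x => pos (p1 x) ^+ 3 * pos (p2 x) ^+ 3.
Proof.
apply/funext => x; rewrite /tube /psi /chi; congr (_ * pos (1 + _ * _) ^+ 3).
by apply: eq_bigr => j _; rewrite !mxE /z /tau; ring.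
Qed.

Let Cn_tau n : Cn n tau.
Proof. by apply: CnD; [exact: Cn_dot|exact: Cn_cst]. Qed.

Let Cn_z n j : Cn n (z j).
Proof.
apply: CnD; first exact: Cn_coord.
by apply: CnD; [apply: CnZ; exact: Cn_tau|exact: Cn_cst].
Qed.

Let Cn_p1 n : Cn n p1.
Proof.
apply: CnD; first exact: Cn_cst.
by apply: CnZ; apply: CnM; exact: Cn_tau.
Qed.

Let Cn_p2 n : Cn n p2.
Proof.
apply: CnD; first exact: Cn_cst.
by apply: CnZ; apply: Cn_sum => j; apply: CnM; exact: Cn_z.
Qed.

Lemma Cn_tube : Cn 2 (tube T r x0 nu s).
Proof. by rewrite tubeE; apply: CnM; apply: Cn_pos3; [exact: Cn_p1|exact: Cn_p2]. Qed.

(** The zeros added here and in [dz], [dp1] and [dp2] are derivatives of constants, kept to match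
    the output of [is_derive_add]. *)
Let d_tau i x : is_derive x (e_ i) tau (nu ord0 i + 0).
Proof. by apply: is_derive_add; rewrite -[nu ord0 i]dot_basis; exact: is_derive_dot. Qed.

Let dz i j : R := (e_ i) ord0 j + (- nu ord0 j * (nu ord0 i + 0) + 0).

Let d_z i j x : is_derive x (e_ i) (z j) (dz i j).
Proof.
apply: is_derive_add; first exact: is_derive_coord.
by apply: is_derive_add; apply: is_derive_scale; exact: d_tau.
Qed.

Let dp1 i x := 0 + - T ^- 2 * (tau x * (nu ord0 i + 0) + tau x * (nu ord0 i + 0)).

Let dp2 i x := 0 + - r ^- 2 * \sum_(j < d) (z j x * dz i j + z j x * dz i j).

Let d_p1 i x : is_derive x (e_ i) p1 (dp1 i x).
Proof.
by apply: is_derive_add; apply: is_derive_scale; apply: is_derive_mul; exact: d_tau.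
Qed.

Let d_p2 i x : is_derive x (e_ i) p2 (dp2 i x).
Proof.
by apply: is_derive_add; apply: is_derive_scale; apply: is_derive_bigsum => j; apply:
    is_derive_mul; exact: d_z.
Qed.

(** Invariance of x - x0 - t nu along [nu]: the sum is nu_j - nu_j |nu|^2. *)
Let sum_dz j : \sum_(i < d) nu ord0 i * dz i j = 0.
Proof.
rewrite (eq_bigr (fun i => nu ord0 i * (e_ i) ord0 j + - nu ord0 j * (nu ord0 i * nu ord0 i)));
    last first.
  by move=> i _; rewrite /dz; ring.
rewrite big_split /= -mulr_sumr -/(dot nu nu) nu1 mulr1 (bigD1 j) //= mxE !eqxx mulr1 big1 ?addr0
    ?subrr //.
by move=> i ij; rewrite mxE eqxx /= (eq_sym j) (negbTE ij) mulr0.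
Qed.

Lemma grad_along_tube x : grad_along nu (tube T r x0 nu s) x =
  dpsi T (dot nu x + s) * chi r (x - x0 - (dot nu x + s) *: nu).
Proof.
have h1 : \sum_(i < d) nu ord0 i * dp1 i x = - T ^- 2 * (2 * tau x).
  rewrite (eq_bigr (fun i => (- T ^- 2 * (2 * tau x)) * (nu ord0 i * nu ord0 i))); last first.
    by move=> i _; rewrite /dp1; ring.
  by rewrite -mulr_sumr -/(dot nu nu) nu1 mulr1.
have h2 : \sum_(i < d) nu ord0 i * dp2 i x = 0.
  rewrite (eq_bigr (fun i => \sum_(j < d) (- r ^- 2 * 2 * z j x) * (nu ord0 i * dz i j))); last
      first.
    by move=> i _; rewrite /dp2 add0r !mulr_sumr; apply: eq_bigr => j _; ring.
  rewrite exchange_big /= big1 // => j _.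
  by rewrite -mulr_sumr sum_dz mulr0.
have dE i : partial i (tube T r x0 nu s) x =
    pos (p1 x) ^+ 3 * (dp2 i x * (3 * pos (p2 x) ^+ 2)) + pos (p2 x) ^+ 3 * (dp1 i x * (3 * pos
        (p1 x) ^+ 2)).
  rewrite tubeE; apply: partial_val; apply: is_derive_mul.
    exact: (is_derive_comp1 (d_p1 i x) (is_derive_pos3 _)).
  exact: (is_derive_comp1 (d_p2 i x) (is_derive_pos3 _)).
rewrite /grad_along (eq_bigr (fun i => (pos (p1 x) ^+ 3 * (3 * pos (p2 x) ^+ 2)) * (nu ord0 i *
    dp2 i x) +
   (pos (p2 x) ^+ 3 * (3 * pos (p1 x) ^+ 2)) * (nu ord0 i * dp1 i x))); last first.
  by move=> i _; rewrite dE; ring.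
rewrite big_split /= -!mulr_sumr h1 h2 mulr0 add0r.
rewrite /dpsi -/(tau x) -/(p1 x) /chi (_ : 1 + - r ^- 2 * _ = p2 x); first by ring.
congr (1 + _ * _).
by apply: eq_bigr => j _; rewrite !mxE /z /tau; ring.
Qed.

End tube_derivatives.

Lemma dot_ge0 (z : E) : 0 <= dot z z.
Proof. by apply: sumr_ge0 => i _; rewrite -expr2 sqr_ge0. Qed.

Lemma coord_dot (z : E) i : z ord0 i ^+ 2 <= dot z z.
Proof. by rewrite /dot (bigD1 i) //= expr2 lerDl sumr_ge0 // => j _; rewrite -expr2 sqr_ge0. Qed.

Lemma pos_le (u v : R) : 0 <= v -> u <= v -> pos u <= v.
Proof. by move=> v0 uv; rewrite /pos ge_max v0. Qed.

Lemma pos_eq0 (u : R) : u <= 0 -> pos u = 0.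
Proof. by move=> u0; rewrite /pos max_l. Qed.

Lemma pos_ge (u : R) : u <= pos u.
Proof. by rewrite /pos le_max lexx orbT. Qed.

Lemma chi_out (r : R) (z : E) : 0 < r -> r ^+ 2 <= dot z z -> chi r z = 0.
Proof.
move=> r0 h; rewrite /chi pos_eq0 ?expr0n // mulNr subr_le0.
by rewrite mulrC ler_pdivlMr ?mul1r // exprn_gt0.
Qed.

Lemma psi_out (T t : R) : 0 < T -> T <= `|t| -> psi T t = 0 /\ dpsi T t = 0.
Proof.
move=> T0 h; have h2 : 1 + - T ^- 2 * (t * t) <= 0.
  rewrite mulNr subr_le0 mulrC ler_pdivlMr ?exprn_gt0 // mul1r -expr2 -(real_normK (num_real t)).
  by rewrite lerXn2r // nnegrE ltW.
by rewrite /psi /dpsi pos_eq0 // !expr0n !mulr0 mul0r.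
Qed.

Lemma tube_bounded_support (T r : R) (x0 nu : E) (s : R) : 0 < T -> 0 < r -> bounded_support
    (tube T r x0 nu s).
Proof.
(* Where the amplitude is nonzero, x = w + x0 + t nu with |w_i| < r and |t| < T. *)
move=> T0 r0; exists (r + `|x0| + T * `|nu|) => [|x nx].
  by rewrite -addrA ltr_wpDr // addr_ge0 // mulr_ge0 // ltW.
have [tT|tT] := leP T `|dot nu x + s|; first by rewrite /tube (psi_out T0 tT).1 mul0r.
rewrite /tube; set w := x - x0 - _.
have [rw|rw] := leP (r ^+ 2) (dot w w); first by rewrite chi_out // mulr0.
exfalso; apply: nx => i.
have wi : `|w ord0 i| < r.
  rewrite -(@ltr_pXn2r _ 2) ?nnegrE ?(ltW r0) //.
  by rewrite (real_normK (num_real _)); apply: le_lt_trans rw; exact: coord_dot.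
have -> : x ord0 i = w ord0 i + (x0 ord0 i + (dot nu x + s) * nu ord0 i).
  by rewrite /w !mxE; ring.
apply: le_lt_trans (ler_normD _ _) _; rewrite -addrA; apply: ltr_leD => //.
apply: le_trans (ler_normD _ _) _; apply: lerD; first exact: le_coord_norm.
by rewrite normrM; apply: ler_pM => //; [exact: ltW|exact: le_coord_norm].
Qed.

Lemma chi_ge0 (r : R) (z : E) : 0 <= chi r z.
Proof. by rewrite exprn_ge0 // pos_ge0. Qed.

Lemma chi_le1 (r : R) (z : E) : chi r z <= 1.
Proof.
rewrite /chi exprn_ile1 ?pos_ge0 //; apply: pos_le => //.
by rewrite mulNr gerDl oppr_le0 mulr_ge0 ?dot_ge0 // invr_ge0 sqr_ge0.
Qed.

Lemma psi_le1 (T t : R) : psi T t <= 1.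
Proof.
rewrite /psi exprn_ile1 ?pos_ge0 //; apply: pos_le => //.
by rewrite mulNr gerDl oppr_le0 mulr_ge0 -?expr2 ?sqr_ge0 // invr_ge0 sqr_ge0.
Qed.

(** (3 / 4)^6 = 729 / 4096 exceeds 1 / 8. *)
Lemma cube_power_ge (u : R) : 3 / 4 <= u -> 8^-1 <= (pos u ^+ 3) ^+ 2.
Proof.
move=> h; have : 3 / 4 <= pos u by apply: le_trans h (pos_ge _).
move: (pos u) => p hp; rewrite -exprM.
have h6 : (3 / 4) ^+ 6 <= p ^+ 6 by rewrite lerXn2r // nnegrE ?divr_ge0 //; apply: le_trans hp;
    rewrite divr_ge0.
by apply: le_trans h6; lra.
Qed.

Lemma psi_ge (T t : R) : 0 < T -> `|t| <= T / 2 -> 8^-1 <= psi T t ^+ 2.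
Proof.
move=> T0 h; apply: cube_power_ge.
have : T ^- 2 * (t * t) <= 4^-1.
  rewrite mulrC ler_pdivrMr ?exprn_gt0 // -expr2 -(real_normK (num_real t)).
  have -> : 4^-1 * T ^+ 2 = (T / 2) ^+ 2 by field.
  by rewrite lerXn2r // nnegrE divr_ge0 // ltW.
by rewrite mulNr; lra.
Qed.

(** The square is 36 p^4 t^2 / T^4 with p <= 1, and |t| < T where it is nonzero. *)
Lemma dpsi_le (T t : R) : 0 < T -> dpsi T t ^+ 2 <= 36 * T ^- 2.
Proof.
move=> T0; have [h|h] := leP T `|t|.
  by rewrite (psi_out T0 h).2 expr0n mulr_ge0 // invr_ge0 sqr_ge0.
rewrite /dpsi; have : pos (1 + - T ^- 2 * (t * t)) <= 1.
  apply: pos_le => //; by rewrite mulNr gerDl oppr_le0 mulr_ge0 -?expr2 ?sqr_ge0 // invr_ge0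
      sqr_ge0.
move: (pos _) (pos_ge0 (1 + - T ^- 2 * (t * t))) => p p0 p1.
have -> : (3 * p ^+ 2 * (- T ^- 2 * (2 * t))) ^+ 2 = 36 * T ^- 2 * (p ^+ 4 * (T ^- 2 * `|t| ^+ 2)).
  by rewrite (real_normK (num_real t)); ring.
rewrite -[leRHS]mulr1 ler_wpM2l ?mulr_ge0 ?invr_ge0 ?sqr_ge0 //.
rewrite mulr_ile1 ?exprn_ge0 ?exprn_ile1 ?mulr_ge0 ?invr_ge0 ?sqr_ge0 //.
by rewrite mulrC ler_pdivrMr ?exprn_gt0 // mul1r lerXn2r // ?nnegrE ltW.
Qed.

Lemma chi_ge (r : R) (z : E) : 0 < r -> dot z z <= r ^+ 2 / 4 -> 8^-1 <= chi r z ^+ 2.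
Proof.
move=> r0 h; apply: cube_power_ge.
have : r ^- 2 * dot z z <= 4^-1.
  by rewrite mulrC ler_pdivrMr ?exprn_gt0 // mulrC.
by rewrite mulNr; lra.
Qed.

End amplitude.

(** * Averaging the amplitude estimate over the family of tubes *)

Section tube_integration.
Variables (R : realType) (d : nat).
Local Notation E := 'rV[R]_d.
Local Notation mu := (lebesgue_rV R d).
Local Notation leb := (@lebesgue_measure R).
Local Notation RE := (measurableTypeR R * 'rV[R]_d)%type.

Lemma measurable_fst_coord : measurable_fun [set: RE] (fun p : RE => p.1 : R).
Proof. exact: measurable_fst. Qed.

Lemma measurable_snd_coord (i : 'I_d) : measurable_fun [set: RE] (fun p : RE => p.2 ord0 i).
Proof.
apply: (measurableT_comp (f := rV_coord i)); first exact: measurable_rV_coord.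
exact: measurable_snd.
Qed.

Lemma measurable_dot (nu : E) : measurable_fun [set: E] (dot nu).
Proof. by apply: continuous_measurable_rV; exact: Cn_continuous (Cn_dot 0 nu). Qed.

Lemma measurable_along (x0 nu : E) :
  measurable_fun [set: RE] (fun p : RE => p.2 - x0 - (p.1 : R) *: nu).
Proof.
apply: measurable_fun_rV => i.
rewrite (_ : _ \o _ = (fun p : RE => p.2 ord0 i + (- x0 ord0 i + - nu ord0 i * (p.1 : R)))); last
    first.
  by apply/funext => p; rewrite /= /rV_coord !mxE; ring.
apply: (@measurable_funD _ RE); first exact: measurable_snd_coord.
apply: (@measurable_funD _ RE) => //; apply: (@measurable_funM _ RE) => //; exact:
    measurable_fst_coord.
Qed.

Lemma measurable_shear (nu : E) :
  measurable_fun [set: RE] (fun p : RE => (((dot nu p.2 + (p.1 : R)) : measurableTypeR R), p.2) :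
      RE).
Proof.
apply: measurable_fun_pair; last exact: measurable_snd.
apply: (@measurable_funD _ RE); last exact: measurable_fst_coord.
by apply: (measurableT_comp (measurable_dot nu)); exact: measurable_snd.
Qed.

(* For fixed [x], [s] and [t = nu.x + s] differ by a translation. *)
Lemma integral_shear (nu : E) (h : RE -> \bar R) : measurable_fun [set: RE] h -> (forall p, 0 <=
    h p)%E ->
  (\int[leb]_s \int[mu]_x h (((dot nu x + (s : R))%R : measurableTypeR R), x) =
   \int[leb]_t \int[mu]_x h (t, x))%E.
Proof.
move=> mh h0.
(* Tonelli brings the [x] integral outside, so that the inner translation by nu.x has a fixed
   length. *)
rewrite (fubini_tonelli (m1 := leb) (m2 := mu) h mh h0).
pose k (p : RE) := h (((dot nu p.2 + (p.1 : R)) : measurableTypeR R), p.2).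
have mk : measurable_fun [set: RE] k by exact: (measurableT_comp mh (measurable_shear nu)).
have k0 p : (0 <= k p)%E by exact: h0.
rewrite [LHS](fubini_tonelli (m1 := leb) (m2 := mu) k mk k0).
apply: eq_integral => x _.
rewrite /k /=; under eq_integral do rewrite addrC.
apply: (@integral_shift R (dot nu x) (fun t => h (t, x))).
exact: (measurableT_comp mh (pair2_measurable x)).
Qed.

Section averaging.
Variables (K B : R) (b : E -> R).
Hypotheses (K0 : 0 < K) (B0 : 0 <= B) (mb : measurable_fun setT b) (bB : {ae mu, forall x, `|b x|
    <= B}).
Hypothesis HK : forall (nu : E) (a : E -> R), dot nu nu = 1 -> Cn 2 a -> bounded_support a ->
  (\int[mu]_x (a x ^+ 2)%:E <= K%:E * \int[mu]_x ((Num.sqrt 2 * grad_along nu a x - b x * a x) ^+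
      2)%:E)%E.

(** By (p - q)^2 <= 2 p^2 + 2 q^2 and b^2 <= B |b|; the second makes the damping term linear in
    |b|. *)
Lemma amplitude_bound (nu : E) (a : E -> R) : dot nu nu = 1 -> Cn 2 a -> bounded_support a ->
  (\int[mu]_x (a x ^+ 2)%:E <=
   \int[mu]_x (4 * K * grad_along nu a x ^+ 2 + 2 * K * B * (`|b x| * a x ^+ 2))%:E)%E.
Proof.
move=> nu1 Ca sa; apply: le_trans (HK nu1 Ca sa) _.
have mg : measurable_fun setT (grad_along nu a).
  apply: continuous_measurable_rV; apply: (@Cn_continuous _ _ 1).
  by apply: Cn_sum => i; apply: CnZ; exact: Cn_partial.
have ma : measurable_fun setT a by apply: continuous_measurable_rV; exact: Cn_continuous Ca.
have mG : measurable_fun setT (fun x => (Num.sqrt 2 * grad_along nu a x - b x * a x) ^+ 2).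
  apply: measurable_funX; apply: measurable_funB; first exact: measurable_funM.
  exact: measurable_funM.
rewrite -ge0_integralZl ?lee_fin ?(ltW K0) //; last 2 first.
- exact/measurable_EFinP.
- by move=> x _; rewrite lee_fin sqr_ge0.
apply: ae_ge0_le_integral => //.
- by move=> x _; rewrite -EFinM lee_fin mulr_ge0 ?sqr_ge0 // ltW.
- by apply: measurable_funeM; exact/measurable_EFinP.
- move=> x _; rewrite lee_fin; apply: addr_ge0; apply: mulr_ge0.
  + by rewrite mulr_ge0 // ltW.
  + exact: sqr_ge0.
  + by rewrite !mulr_ge0 // ltW.
  + by apply: mulr_ge0 => //; exact: sqr_ge0.
- apply/measurable_EFinP; apply: measurable_funD.
    by apply: measurable_funM => //; exact: measurable_funX.
  apply: measurable_funM => //; apply: measurable_funM; last exact: measurable_funX.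
  exact: measurableT_comp.
apply: filterS bB => x bx _; rewrite -EFinM lee_fin.
have s2 : Num.sqrt 2 ^+ 2 = 2 :> R by rewrite sqr_sqrtr.
move: (grad_along nu a x) (a x) => D y.
have h1 : (Num.sqrt 2 * D - b x * y) ^+ 2 <= 4 * D ^+ 2 + 2 * (`|b x| ^+ 2 * y ^+ 2).
  rewrite (real_normK (num_real _)).
  have -> : 4 * D ^+ 2 = 2 * (Num.sqrt 2 * D) ^+ 2 by rewrite exprMn s2; ring.
  rewrite -exprMn -subr_ge0; move: (Num.sqrt 2 * D) (b x * y) => p q.
  have -> : 2 * p ^+ 2 + 2 * q ^+ 2 - (p - q) ^+ 2 = (p + q) ^+ 2 by ring.
  exact: sqr_ge0.
have h2 : `|b x| ^+ 2 * y ^+ 2 <= B * (`|b x| * y ^+ 2).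
  by rewrite expr2 -mulrA ler_wpM2r // mulr_ge0 ?sqr_ge0.
have -> : 4 * K * D ^+ 2 + 2 * K * B * (`|b x| * y ^+ 2) = K * (4 * D ^+ 2 + 2 * (B * (`|b x| * y
    ^+ 2))) by ring.
rewrite ler_wpM2l ?(ltW K0) //; apply: le_trans h1 _.
by rewrite lerD2l ler_wpM2l.
Qed.

Variables (T r : R) (x0 nu : E).
Hypotheses (T0 : 0 < T) (r0 : 0 < r) (nu1 : dot nu nu = 1).

Let w (p : RE) : E := p.2 - x0 - (p.1 : R) *: nu.

(** At (t, x) with t = nu.x + s, [hL] and [hR] are the two integrands of [amplitude_bound] for the
    amplitude [tube] with shift s. *)
Let hL (p : RE) : \bar R := (psi T p.1 ^+ 2 * chi r (w p) ^+ 2)%:E.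

Let hR (p : RE) : \bar R :=
  (4 * K * (dpsi T p.1 ^+ 2 * chi r (w p) ^+ 2) + 2 * K * B * (`|b p.2| * (psi T p.1 ^+ 2 * chi r
      (w p) ^+ 2)))%:E.

Lemma measurable_chi : measurable_fun [set: E] (chi r).
Proof.
apply: continuous_measurable_rV; apply: (@Cn_continuous _ _ 2).
apply: Cn_pos3; apply: CnD; first exact: Cn_cst.
by apply: CnZ; apply: Cn_sum => i; apply: CnM; exact: Cn_coord.
Qed.

Let measurable_chiw : measurable_fun [set: RE] (fun p => chi r (w p)).
Proof. exact: (measurableT_comp measurable_chi (measurable_along x0 nu)). Qed.

Let continuous_posp (c : R) n : continuous (fun t : R => pos (1 + c * (t * t)) ^+ n).
Proof.
move=> t; apply: (@continuous_comp _ _ _ (fun t : R => 1 + c * (t * t)) (fun u => pos u ^+ n)).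
  apply: cvgD; first exact: cvg_cst.
  by apply: cvgMr; apply: cvgM; exact: cvg_id.
exact: (@continuous_comp _ _ _ (@pos R) (fun x : R => x ^+ n) _ (@pos_continuous R _)
    (@exprn_continuous R n _)).
Qed.

Let measurable_psi : measurable_fun [set: RE] (fun p : RE => psi T p.1).
Proof.
apply: (measurableT_comp (f := psi T)); last exact: measurable_fst.
by apply: continuous_measurable_fun; exact: continuous_posp.
Qed.

Let measurable_dpsi : measurable_fun [set: RE] (fun p : RE => dpsi T p.1).
Proof.
apply: (measurableT_comp (f := dpsi T)); last exact: measurable_fst.
apply: continuous_measurable_fun => t; apply: cvgM; first by apply: cvgMr; exact: continuous_posp.
by apply: cvgMr; apply: cvgMr; exact: cvg_id.
Qed.

Let mb2 : measurable_fun [set: RE] (fun p : RE => `|b p.2|).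
Proof.
apply: (measurableT_comp (f := fun x : E => `|b x|)); last exact: measurable_snd.
exact: measurableT_comp.
Qed.

Let mhL : measurable_fun [set: RE] hL.
Proof. by apply/measurable_EFinP; apply: measurable_funM; exact: measurable_funX. Qed.

Let mhR : measurable_fun [set: RE] hR.
Proof.
apply/measurable_EFinP; apply: measurable_funD.
  by apply: measurable_funM => //; apply: measurable_funM; exact: measurable_funX.
apply: measurable_funM => //; apply: measurable_funM => //.
by apply: measurable_funM; exact: measurable_funX.
Qed.

Let hL0 p : (0 <= hL p)%E.
Proof. by rewrite lee_fin mulr_ge0 // sqr_ge0. Qed.

Let hR0 p : (0 <= hR p)%E.
Proof.
rewrite lee_fin; apply: addr_ge0; apply: mulr_ge0.
- by rewrite mulr_ge0 // ltW.
- by apply: mulr_ge0; exact: sqr_ge0.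
- by rewrite !mulr_ge0 // ltW.
- by apply: mulr_ge0 => //; apply: mulr_ge0; exact: sqr_ge0.
Qed.

(** [amplitude_bound] is integrated over s, and [integral_shear] turns s into t on both sides. *)
Lemma averaged_bound :
  (\int[leb]_t \int[mu]_x hL (t, x) <= \int[leb]_t \int[mu]_x hR (t, x))%E.
Proof.
rewrite -(integral_shear nu mhL hL0) -(integral_shear nu mhR hR0).
have mk h : measurable_fun [set: RE] h -> (forall p, 0 <= h p)%E ->
   measurable_fun setT (fun s : measurableTypeR R => \int[mu]_x h (((dot nu x + (s : R))%R :
       measurableTypeR R), x))%E.
  move=> mh h0.
  pose k (p : RE) := h (((dot nu p.2 + (p.1 : R)) : measurableTypeR R), p.2).
  have mk : measurable_fun [set: RE] k by exact: (measurableT_comp mh (measurable_shear nu)).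
  exact: (measurable_fun_fubini_tonelli_F (m2 := mu) k mk (fun p => h0 _)).
apply: ge0_le_integral => //.
- by move=> s _; apply: integral_ge0.
- exact: mk.
- exact: mk.
move=> s _.
have -> : (\int[mu]_x hL ((dot nu x + (s : R))%R : measurableTypeR R, x) =
    \int[mu]_x (tube T r x0 nu s x ^+ 2)%:E)%E.
  by apply: eq_integral => x _; rewrite /tube (exprMn _ (psi T _)).
have -> : (\int[mu]_x hR ((dot nu x + (s : R))%R : measurableTypeR R, x) =
    \int[mu]_x (4 * K * grad_along nu (tube T r x0 nu s) x ^+ 2 + 2 * K * B * (`|b x| * tube T r
        x0 nu s x ^+ 2))%:E)%E.
  by apply: eq_integral => x _; rewrite grad_along_tube // /tube (exprMn _ (dpsi T _)) (exprMn _
      (psi T _)).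
exact: amplitude_bound nu1 (Cn_tube T r x0 nu s) (tube_bounded_support x0 nu s T0 r0).
Qed.

Definition centred_ball : set E := [set z | dot z z < r ^+ 2].

Lemma measurable_centred_ball : measurable centred_ball.
Proof.
rewrite (_ : centred_ball = setT `&` (fun z => dot z z) @^-1` `]-oo, r ^+ 2[%classic).
  apply: continuous_measurable_rV => //; apply: (@Cn_continuous _ _ 0).
  by apply: Cn_sum => i; apply: CnM; exact: Cn_coord.
by rewrite setTI; apply/seteqP; split => z /=; rewrite in_itv.
Qed.

(* Up to the normalisation of kappa_r, the value of [b * kappa_r] at [x0 + t nu]. *)
Definition swept (t : R) : \bar R := (\int[mu]_x (`|b x| * \1_centred_ball (x - x0 - t *: nu))%:E)%E.

Let hJ (p : RE) : \bar R := (`|b p.2| * \1_centred_ball (w p))%:E.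

Let mhJ : measurable_fun [set: RE] hJ.
Proof.
apply/measurable_EFinP; apply: measurable_funM => //.
apply: (measurableT_comp (f := \1_centred_ball : E -> R)); last exact: measurable_along.
by apply: measurable_indic; exact: measurable_centred_ball.
Qed.

Lemma measurable_swept : measurable_fun [set: measurableTypeR R] (swept : measurableTypeR R ->
    \bar R).
Proof.
apply: (measurable_fun_fubini_tonelli_F (m2 := mu) hJ mhJ) => p.
by rewrite lee_fin mulr_ge0 // indicE.
Qed.

Lemma swept_ge0 t : (0 <= swept t)%E.
Proof. by apply: integral_ge0 => x _; rewrite lee_fin mulr_ge0 // indicE. Qed.

Definition chi_mass : \bar R := (\int[mu]_x (chi r x ^+ 2)%:E)%E.

Let shift_mass t : (\int[mu]_x (chi r (x - x0 - t *: nu) ^+ 2)%:E = chi_mass)%E.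
Proof.
rewrite /chi_mass -[RHS](integral_shift_rV (- x0 - t *: nu) (f := fun x => (chi r x ^+ 2)%:E));
    last first.
  by apply/measurable_EFinP; apply: measurable_funX; exact: measurable_chi.
by apply: eq_integral => x _; rewrite addrA.
Qed.

Let mchi (t : R) : measurable_fun setT (fun x : E => chi r (x - x0 - t *: nu) ^+ 2).
Proof.
apply: measurable_funX; apply: (measurableT_comp measurable_chi).
rewrite (_ : (fun x => _) = fun x : E => x + (- x0 - t *: nu)); first exact: measurable_shift_rV.
by apply/funext => x; rewrite addrA.
Qed.

Let chi_mass_ge0 : (0 <= chi_mass)%E.
Proof. by apply: integral_ge0 => x _; rewrite lee_fin sqr_ge0. Qed.

(** On |t| <= T / 2, an interval of length T, psi^2 >= 1 / 8; translation invariance makes the mass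
    of chi^2 independent of t. *)
Let lower : ((T / 8)%:E * chi_mass <= \int[leb]_t \int[mu]_x hL (t, x))%E.
Proof.
pose D : set (measurableTypeR R) := `[- (T / 2), T / 2]%classic.
have mD : measurable D by exact: measurable_itv.
have T8 : ((T / 8)%:E * chi_mass = \int[leb]_(t in D) ((8^-1)%:E * chi_mass))%E.
  rewrite integral_cst //= lebesgue_measure_itv /= lte_fin ifT; last by rewrite gtrN // divr_gt0.
  rewrite muleAC -EFinB -EFinM; congr (_%:E * _)%E; lra.
rewrite T8.
apply: (@le_trans _ _ (\int[leb]_(t in D) \int[mu]_x hL (t, x))%E); last first.
  apply: ge0_subset_integral => //.
    exact: (measurable_fun_fubini_tonelli_F (m2 := mu) hL mhL hL0).
  by move=> t _; apply: integral_ge0 => x _; exact: hL0.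
apply: ge0_le_integral => //.
- by move=> t _; rewrite mule_ge0.
- apply: (measurable_funTS (measurable_fun_fubini_tonelli_F (m2 := mu) hL mhL hL0)).
move=> t; rewrite /D /= in_itv /= -ler_norml => tT.
rewrite -(shift_mass t) -ge0_integralZl //; last 2 first.
- by apply/measurable_EFinP; exact: mchi.
- by move=> x _; rewrite lee_fin sqr_ge0.
apply: ge0_le_integral => //.
- by move=> x _; rewrite mule_ge0 // lee_fin sqr_ge0.
- by apply: measurable_funeM; apply/measurable_EFinP; exact: mchi.
- exact: (measurableT_comp mhL (pair1_measurable _)).
move=> x _; rewrite /hL /w /= -EFinM lee_fin ler_wpM2r ?sqr_ge0 //.
exact: psi_ge.
Qed.

(** [dpsi_le] gives 4 K * 36 / T^2 = 144 K / T^2, and the interval of length 2 T turns it into 288 K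
    / T. In the damping term psi^2 chi^2 is at most the indicator of the moving ball. *)
Let upper : (\int[leb]_t \int[mu]_x hR (t, x) <=
  (288 * K / T)%:E * chi_mass + (2 * K * B)%:E * \int[leb]_(t in `[(- T)%R, T]) swept t)%E.
Proof.
pose D : set (measurableTypeR R) := `[- T, T]%classic.
have mD : measurable D by exact: measurable_itv.
have c0 : 0 <= 144 * K * T ^- 2 by rewrite !mulr_ge0 ?invr_ge0 ?sqr_ge0 // ltW.
have c1 : 0 <= 2 * K * B by rewrite !mulr_ge0 // ltW.
have cE : ((288 * K / T)%:E * chi_mass = \int[leb]_(t in D) ((144 * K * T ^- 2)%:E * chi_mass))%E.
  rewrite integral_cst //= lebesgue_measure_itv /= lte_fin ifT; last by rewrite gtrN.
  rewrite muleAC -EFinB -EFinM; congr (_%:E * _)%E.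
  by field; rewrite gt_eqF.
rewrite cE -[X in (_ <= _ + X)%E]ge0_integralZl ?lee_fin //; last 2 first.
- by apply: measurable_funTS; exact: measurable_swept.
- by move=> t _; exact: swept_ge0.
rewrite -ge0_integralD //; last 3 first.
- by move=> t _; rewrite mule_ge0.
- by move=> t _; rewrite mule_ge0 // swept_ge0.
- by apply: measurable_funeM; apply: measurable_funTS; exact: measurable_swept.
have inner t : ~ D t -> (\int[mu]_x hR (t, x) = 0)%E.
  rewrite /D /= in_itv /= -ler_norml => /negP; rewrite -ltNge => /ltW Tt.
  have [p0 dp0] := psi_out T0 Tt.
  rewrite (eq_integral (cst 0%E)); first exact: integral0.
  by move=> x _; rewrite /hR /= p0 dp0 !expr0n /= !mul0r !mulr0 addr0.
rewrite (_ : (\int[leb]_t \int[mu]_x hR (t, x) = \int[leb]_(t in D) \int[mu]_x hR (t, x))%E);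
    last first.
  rewrite [RHS]integral_mkcond; apply: eq_integral => t _; rewrite /patch.
  by case: ifPn => // /negP tD; rewrite inner // => Dt; apply: tD; rewrite inE.
apply: ge0_le_integral => //.
- by move=> t _; apply: integral_ge0 => x _; exact: hR0.
- exact: (measurable_funTS (measurable_fun_fubini_tonelli_F (m2 := mu) hR mhR hR0)).
- apply: emeasurable_funD => //; apply: measurable_funeM; apply: measurable_funTS; exact:
    measurable_swept.
move=> t Dt; rewrite -(shift_mass t) /swept.
have mJt : measurable_fun setT (fun x : E => (`|b x| * \1_centred_ball (x - x0 - t *: nu))%:E).
  exact: (measurableT_comp mhJ (pair1_measurable _)).
have Jt0 x : (0 <= (`|b x| * \1_centred_ball (x - x0 - t *: nu))%:E)%E by rewrite lee_fin mulr_ge0 //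
    indicE.
have mCt : measurable_fun setT (fun x : E => (chi r (x - x0 - t *: nu) ^+ 2)%:E) by
    apply/measurable_EFinP; exact: mchi.
have Ct0 x : (0 <= (chi r (x - x0 - t *: nu) ^+ 2)%:E)%E by rewrite lee_fin sqr_ge0.
rewrite -!ge0_integralZl ?lee_fin // -ge0_integralD //; last 4 first.
- by move=> x _; rewrite mule_ge0.
- exact: measurable_funeM.
- by move=> x _; rewrite mule_ge0.
- exact: measurable_funeM.
apply: ge0_le_integral => //.
- exact: (measurableT_comp mhR (pair1_measurable _)).
- by apply: emeasurable_funD; exact: measurable_funeM.
move=> x _; rewrite /hR /w /= -!EFinM -EFinD lee_fin; apply: lerD.
  have -> : 144 * K * T ^- 2 * chi r (x - x0 - t *: nu) ^+ 2 =
     4 * K * (36 * T ^- 2 * chi r (x - x0 - t *: nu) ^+ 2) by ring.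
  rewrite ler_wpM2l ?mulr_ge0 ?(ltW K0) // ler_wpM2r ?sqr_ge0 //; exact: dpsi_le.
rewrite ler_wpM2l // ler_wpM2l // indicE.
case: (boolP (_ \in centred_ball)) => [_|zd].
  apply: mulr_ile1; rewrite ?sqr_ge0 // expr_le1 ?psi_le1 ?chi_le1 ?chi_ge0 //.
  by rewrite exprn_ge0 // pos_ge0.
rewrite chi_out ?expr0n ?mulr0 // leNgt; apply/negP => h; move/negP: zd; apply.
by rewrite inE.
Qed.

Lemma tube_average : ((T / 8)%:E * chi_mass <=
  (288 * K / T)%:E * chi_mass + (2 * K * B)%:E * \int[leb]_(t in `[(- T)%R, T]) swept t)%E.
Proof. exact: le_trans lower (le_trans averaged_bound upper). Qed.

End averaging.

End tube_integration.

(** * Volumes of balls, and convolution with the kernel *)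

Section convolution_averages.
Variables (R : realType) (d : nat).
Hypothesis d0 : (0 < d)%N.
Local Notation E := 'rV[R]_d.
Local Notation mu := (lebesgue_rV R d).
Local Notation leb := (@lebesgue_measure R).

Lemma sqr_eucl_norm (y : E) : eucl_norm y ^+ 2 = dot y y.
Proof.
rewrite sqr_sqrtr; last by apply: sumr_ge0 => i _; exact: sqr_ge0.
by apply: eq_bigr => i _; rewrite expr2.
Qed.

Lemma eucl_norm_ge0 (y : E) : 0 <= eucl_norm y.
Proof. exact: sqrtr_ge0. Qed.

Lemma unit_eucl_ballE : eucl_ball (0 : E) 1 = centred_ball 1.
Proof.
apply/seteqP; split => y; rewrite /eucl_ball /centred_ball /= subr0 -sqr_eucl_norm ltr_pXn2r //
    nnegrE ?eucl_norm_ge0 //.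
Qed.

(** With half-side r / (2 d), the d squares add up to at most r^2 / (4 d). *)
Lemma dot_cube (r : R) (z : E) : 0 < r -> cube d (r / (2 * d%:R)) z -> dot z z <= r ^+ 2 / 4.
Proof.
move=> r0 zr; have dR : 1 <= d%:R :> R by rewrite ler1n.
have dp : 0 < d%:R :> R by rewrite ltr0n.
have rp : 0 <= r / (2 * d%:R) by rewrite divr_ge0 ?mulr_ge0 // ltW.
apply: (@le_trans _ _ (\sum_(i < d) (r / (2 * d%:R)) ^+ 2)).
  apply: ler_sum => i _; rewrite -expr2 -(real_normK (num_real _)).
  by rewrite lerXn2r ?nnegrE // ltW.
rewrite sumr_const card_ord -[leLHS]mulr_natl.
have -> : d%:R * (r / (2 * d%:R)) ^+ 2 = r ^+ 2 / 4 / d%:R by field; rewrite gt_eqF.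
by rewrite ler_pdivrMr // ler_peMr // divr_ge0 // sqr_ge0.
Qed.

Lemma centred_ball_cube (r : R) : 0 < r -> centred_ball r `<=` cube d r.
Proof.
move=> r0 z zr i; rewrite -(@ltr_pXn2r _ 2) ?nnegrE ?(ltW r0) //.
by rewrite (real_normK (num_real _)); apply: le_lt_trans zr; exact: coord_dot.
Qed.

Lemma cube_side_gt0 (r : R) : 0 < r -> 0 < r / (2 * d%:R).
Proof. by move=> r0; rewrite divr_gt0 // mulr_gt0 // ltr0n. Qed.

Lemma cube_side (r : R) : 2 * (r / (2 * d%:R)) = r / d%:R.
Proof. by field; rewrite pnatr_eq0 -lt0n. Qed.

(** chi^2 >= 1 / 8 on the inscribed cube of side r / d. The power r^d here later cancels that of the
    kernel. *)
Lemma chi_mass_ge (r : R) : 0 < r -> (((r / d%:R) ^+ d / 8)%:E <= chi_mass d r)%E.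
Proof.
move=> r0; pose C : set E := cube d (r / (2 * d%:R)).
have mC : measurable C by exact: measurable_cube.
have -> : (((r / d%:R) ^+ d / 8)%:E = \int[mu]_(x in C) (8^-1)%:E)%E.
  rewrite integral_cst // [X in (_ * X)%E](lebesgue_cube d (cube_side_gt0 r0)) cube_side.
  by rewrite -EFinM mulrC.
have mchi : measurable_fun setT (fun x : E => (chi r x ^+ 2)%:E).
  apply/measurable_EFinP; apply: measurable_funX; exact: measurable_chi.
apply: (@le_trans _ _ (\int[mu]_(x in C) (chi r x ^+ 2)%:E)%E); last first.
  by apply: ge0_subset_integral => // x _; rewrite lee_fin sqr_ge0.
apply: ge0_le_integral => //.
- exact: measurable_funTS.
- by move=> x Cx; rewrite lee_fin chi_ge // dot_cube.
Qed.

(** Finiteness allows the gradient term to be subtracted in the final absorption. *)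
Lemma chi_mass_fin (r : R) : 0 < r -> (chi_mass d r < +oo)%E.
Proof.
move=> r0; have mC : measurable (cube d r) by exact: measurable_cube.
apply: (@le_lt_trans _ _ (\int[mu]_x (\1_(cube d r) x)%:E)%E); last first.
  by rewrite integral_indic // setIT [X in (X < _)%E](lebesgue_cube d r0) ltry.
apply: ge0_le_integral => //.
- by move=> x _; rewrite lee_fin sqr_ge0.
- by apply/measurable_EFinP; apply: measurable_funX; exact: measurable_chi.
- by apply/measurable_EFinP; exact: measurable_indic.
move=> x _; rewrite lee_fin indicE; case: (boolP (x \in _)) => [_|xC].
  by rewrite expr_le1 ?chi_le1 ?chi_ge0.
rewrite chi_out ?expr0n // leNgt; apply/negP => h; move/negP: xC; apply.
by rewrite inE; exact: centred_ball_cube.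
Qed.

(** [kappa] divides by [fine] of this volume, which would be 0 for an infinite one. Cubes inside and
    around the ball decide both bounds. *)
Lemma unit_ball_volume : (0 < mu (eucl_ball 0 1) < +oo)%E.
Proof.
have m1 : measurable (centred_ball 1 : set E) by exact: measurable_centred_ball.
rewrite unit_eucl_ballE; apply/andP; split.
  have h : (mu (cube d (1 / (2 * d%:R))) <= mu (centred_ball 1))%E.
    apply: le_measure; rewrite ?inE //; first exact: measurable_cube.
    move=> z zc; rewrite /centred_ball /=; apply: le_lt_trans (dot_cube ltr01 zc) _.
    by rewrite expr1n; lra.
  apply: lt_le_trans h; rewrite (lebesgue_cube d (cube_side_gt0 ltr01)) lte_fin.
  by rewrite exprn_gt0 // mulr_gt0 // cube_side_gt0.
apply: (@le_lt_trans _ _ (mu (cube d 1))); last by rewrite (lebesgue_cube d ltr01) ltry.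
apply: le_measure; rewrite ?inE //; [exact: measurable_cube|exact: centred_ball_cube].
Qed.

Variables (b : E -> R) (B r : R) (x0 nu : E).
Hypotheses (mb : measurable_fun setT b) (bB : {ae mu, forall x, `|b x| <= B}).
Hypotheses (B0 : 0 <= B) (b0 : {ae mu, forall x, 0 <= b x}) (r0 : 0 < r).

Let measurable_centred_ball_shift (t : R) :
  measurable_fun setT (fun y : E => \1_(centred_ball r) (y - x0 - t *: nu) : R).
Proof.
apply: (measurableT_comp (f := \1_(centred_ball r) : E -> R)).
  by apply: measurable_indic; exact: measurable_centred_ball.
rewrite (_ : (fun x => _) = fun x : E => x + (- x0 - t *: nu)); first exact: measurable_shift_rV.
by apply/funext => x; rewrite addrA.
Qed.

Lemma swept_le (t : R) : (swept b r x0 nu t <= (B * (2 * r) ^+ d)%:E)%E.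
Proof.
have mC : measurable (cube d r) by exact: measurable_cube.
have mind : measurable_fun setT (fun x : E => (\1_(cube d r) x : R)%:E).
  by apply/measurable_EFinP; exact: measurable_indic.
have -> : ((B * (2 * r) ^+ d)%:E = \int[mu]_x (B%:E * (\1_(cube d r) (x - x0 - t *: nu))%:E))%E.
  have -> : (\int[mu]_x (B%:E * (\1_(cube d r) (x - x0 - t *: nu))%:E) =
    \int[mu]_x (B%:E * (\1_(cube d r) (x + (- x0 - t *: nu))%R)%:E))%E.
    by apply: eq_integral => x _; rewrite addrA.
  rewrite (integral_shift_rV (- x0 - t *: nu) (f := fun x => (B%:E * (\1_(cube d r) x)%:E)%E));
      last first.
    exact: measurable_funeM.
  rewrite ge0_integralZl // integral_indic // setIT.
  by rewrite [X in (_ * X)%E](lebesgue_cube d r0).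
apply: ae_ge0_le_integral => //.
- apply/measurable_EFinP; apply: measurable_funM => //; exact: measurableT_comp.
- by move=> x _; rewrite mule_ge0 // lee_fin indicE.
- apply: measurable_funeM.
  rewrite (_ : (fun x => _) = (fun x : E => (\1_(cube d r) x : R)%:E) \o (fun x : E => x + (- x0
      - t *: nu))).
    by apply: measurableT_comp => //; exact: measurable_shift_rV.
  by apply/funext => x /=; rewrite addrA.
apply: filterS bB => x bx _; rewrite -EFinM lee_fin; apply: ler_pM => //.
rewrite !indicE; case: (boolP (_ \in centred_ball r)) => [/set_mem /(centred_ball_cube r0) h|_];
    last by rewrite ler0n.
by rewrite mem_set.
Qed.

Let swept_fin (t : R) : swept b r x0 nu t \is a fin_num.
Proof. by rewrite ge0_fin_numE ?swept_ge0 //; apply: le_lt_trans (swept_le t) (ltry _). Qed.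

Local Notation beta := (fine (mu (eucl_ball 0 1))).

Lemma convolution_kappaE (t : R) : convolution b (kappa_r r) (x0 + t *: nu) =
  (r ^+ d)^-1 * beta^-1 * fine (swept b r x0 nu t).
Proof.
have beta0 : 0 <= beta by rewrite fine_ge0.
pose c0 := (r ^+ d)^-1 * beta^-1.
have c00 : 0 <= c0 by rewrite mulr_ge0 // invr_ge0 // exprn_ge0 // ltW.
(* The ball is symmetric, so the sign of its argument can be reversed. *)
have kE y : kappa_r r (x0 + t *: nu - y) = c0 * \1_(centred_ball r) (y - x0 - t *: nu).
  have dE : dot (r^-1 *: (x0 + t *: nu - y)) (r^-1 *: (x0 + t *: nu - y)) =
     dot (y - x0 - t *: nu) (y - x0 - t *: nu) / r ^+ 2.
    rewrite /dot mulr_suml; apply: eq_bigr => i _; rewrite !mxE.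
    by field; rewrite gt_eqF.
  have iffE : centred_ball 1 (r^-1 *: (x0 + t *: nu - y)) <-> centred_ball r (y - x0 - t *: nu).
    by rewrite /centred_ball /= dE ltr_pdivrMr ?exprn_gt0 // expr1n mul1r.
  rewrite /kappa_r /kappa (_ : \1_(eucl_ball 0 1) _ = \1_(centred_ball r) (y - x0 - t *: nu))
      ?mulrA //.
  rewrite unit_eucl_ballE !indicE; congr ((nat_of_bool _)%:R).
  by apply/idP/idP; rewrite !inE => /iffE.
rewrite /convolution /Rintegral -[in RHS](fineK (swept_fin t)) /=.
have -> : (\int[mu]_y (b y * kappa_r r (x0 + t *: nu - y))%:E = c0%:E * swept b r x0 nu t)%E.
  rewrite /swept -ge0_integralZl ?lee_fin //; last first.
    apply/measurable_EFinP; apply: measurable_funM => //; exact: measurableT_comp.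
  apply: ae_eq_integral => //.
  - apply/measurable_EFinP; under eq_fun do rewrite kE.
    by apply: measurable_funM => //; exact: measurable_funM.
  - apply: measurable_funeM; apply/measurable_EFinP; apply: measurable_funM => //; exact:
      measurableT_comp.
  apply: filterS b0 => y by0 _; rewrite kE -EFinM (ger0_norm by0); congr EFin; ring.
by rewrite fineM.
Qed.

(** The real integral would take a default value if the extended one were infinite; the bound
    [swept_le], uniform in t, excludes this. *)
Lemma Rintegral_convolution (T : R) : 0 < T ->
  exists2 J : R, (\int[leb]_(t in `[(- T)%R, T]) swept b r x0 nu t = J%:E)%E &
    \int[leb]_(t in `[- T, T]) convolution b (kappa_r r) (x0 + t *: nu) = (r ^+ d)^-1 * beta^-1 * J.
Proof.
move=> T0; pose D : set (measurableTypeR R) := `[- T, T]%classic.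
have mD : measurable D by exact: measurable_itv.
have msw : measurable_fun D (swept b r x0 nu) by apply: measurable_funTS; exact: measurable_swept.
have Jfin : (\int[leb]_(t in D) swept b r x0 nu t)%E \is a fin_num.
  rewrite ge0_fin_numE; last by apply: integral_ge0 => t _; exact: swept_ge0.
  apply: (@le_lt_trans _ _ (\int[leb]_(t in D) (B * (2 * r) ^+ d)%:E)%E).
    apply: ge0_le_integral => //.
    - by move=> t _; exact: swept_ge0.
    - by move=> t _; exact: swept_le.
  rewrite integral_cst //= lebesgue_measure_itv /= lte_fin ifT; last by rewrite gtrN.
  by rewrite -EFinB -EFinM ltry.
exists (fine (\int[leb]_(t in D) swept b r x0 nu t)%E); first by rewrite fineK.
rewrite /Rintegral.
have -> : (\int[leb]_(t in D) (convolution b (kappa_r r) (x0 + t *: nu)%R)%:E =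
    ((r ^+ d)^-1 * beta^-1)%:E * \int[leb]_(t in D) swept b r x0 nu t)%E.
  have c0 : 0 <= (r ^+ d)^-1 * beta^-1 by rewrite mulr_ge0 // invr_ge0 ?fine_ge0 // exprn_ge0 //
      ltW.
  rewrite -ge0_integralZl ?lee_fin //; last by move=> t _; exact: swept_ge0.
  by apply: eq_integral => t _; rewrite convolution_kappaE EFinM fineK.
by rewrite fineM.
Qed.

End convolution_averages.

Theorem proposition1p2 (R : realType) (d : nat) (hd : (0 < d)%N)
    (V : 'rV[R]_d -> R)
    (V_Linf_loc : Linf_loc V)
    (V_ge0 : {ae lebesgue_rV R d, forall x, 0 <= V x})
    (V_pinfty : tends_to_pinfty V)
    (b : 'rV[R]_d -> R)
    (b_Linf : b \in Lfun (lebesgue_rV R d) +oo%E)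
    (b_ge0 : {ae lebesgue_rV R d, forall x, 0 <= b x})
    (stable : uniformly_stable V b) :
  exists T c : R, [/\ 0 < T, 0 < c &
    forall (x0 nu0 : 'rV[R]_d) (r : R), eucl_norm nu0 = 1 -> 0 < r ->
      c <= (2 * T)^-1 *
           \int[lebesgue_measure]_(t in `[- T, T])
              convolution b (kappa_r r) (x0 + t *: nu0)].
Proof.
have [mb [M M0 bM]] := Linf_ae_bounded b_Linf.
(* [M] may be 0, while [c] involves the inverse of [B]. *)
pose B := M + 1.
have B0 : 0 < B by rewrite ltr_wpDl.
have bB : {ae lebesgue_rV R d, forall x, `|b x| <= B}.
  by apply: filterS bM => x /le_trans; apply; rewrite lerDl.
have [K K0 HK] := stable_amplitude V_Linf_loc b_Linf stable.
have /andP[v0 vy] := @unit_ball_volume R d hd.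
set beta := fine (lebesgue_rV R d (eucl_ball 0 1)).
have beta0 : 0 < beta by rewrite fine_gt0 // v0.
have dR : 0 < d%:R ^+ d :> R by rewrite exprn_gt0 // ltr0n.
(* [T] makes the constant [288 K / T] of [tube_average] at most [T / 16]. *)
pose T := 16 * (288 * K) + 1; pose c := (2 * beta * (128 * d%:R ^+ d) * (2 * K * B))^-1.
have T1 : 1 <= T by rewrite /T; move: K0; lra.
have T0 : 0 < T by exact: lt_le_trans T1.
have KB : 0 < 2 * K * B by rewrite !mulr_gt0.
exists T, c; split => //; first by rewrite invr_gt0 !mulr_gt0.
move=> x0 nu r nu_unit r0.
have nu1 : dot nu nu = 1 by rewrite -sqr_eucl_norm nu_unit expr1n.
have [J JE ->] := Rintegral_convolution x0 nu mb bB (ltW B0) b_ge0 r0 T0.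
have chi_mass_gt := chi_mass_ge hd r0; have massy := chi_mass_fin d r0.
have := tube_average K0 (ltW B0) mb bB HK x0 T0 r0 nu1.
rewrite JE; move: chi_mass_gt massy; case: (chi_mass d r) => [m| |] //.
rewrite -!EFinM -EFinD !lee_fin => m_ge _ est.
have rd0 : 0 < r ^+ d by rewrite exprn_gt0.
have m0 : 0 <= m by apply: le_trans m_ge; rewrite divr_ge0 // exprn_ge0 // divr_ge0 // ltW.
(* The summand 1 in [T] gives T <= T^2, so that 288 K <= T / 16 implies 288 K <= T^2 / 16. *)
have small : 288 * K / T <= T / 16.
  rewrite ler_pdivrMr // mulrAC ler_pdivlMr //.
  have : T <= T * T by rewrite ler_peMr // ltW.
  by rewrite /T; lra.
(* T / 8 - T / 16 = T / 16 is left once the gradient term is absorbed. *)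
have J_ge : T / 16 * m <= 2 * K * B * J.
  have := ler_wpM2r m0 small; move: est; move: (288 * K / T) (2 * K * B) => p q.
  by lra.
have main : T * r ^+ d / (128 * d%:R ^+ d) <= 2 * K * B * J.
  apply: le_trans J_ge; have -> : T * r ^+ d / (128 * d%:R ^+ d) = T / 16 * ((r / d%:R) ^+ d / 8).
    by rewrite expr_div_n; field; rewrite gt_eqF.
  by rewrite ler_wpM2l // divr_ge0 // ltW.
(* [T] and r^d cancel, which makes [c] independent of [r]; 128 is 16 from the absorption times 8
   from [chi_mass_ge]. *)
have -> : c = (2 * T)^-1 * ((r ^+ d)^-1 * beta^-1 * (T * r ^+ d / (128 * d%:R ^+ d) / (2 * K * B))).
  by rewrite /c; field; rewrite !gt_eqF.
have pos_c : 0 <= (r ^+ d)^-1 * beta^-1 by rewrite mulr_ge0 // invr_ge0 ltW.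
rewrite ler_wpM2l ?invr_ge0 ?mulr_ge0 ?(ltW T0) // ler_wpM2l //.
by rewrite ler_pdivrMr // [leRHS]mulrC.
Qed.
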